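(* Let $(M,g)$ be a complete Riemannian manifold, let $P: TM \to TM$ be a smooth symmetric bundle endomorphism, and let $f \in C^2(M)$ be a proper nonnegative function. Assume there exist constants $\alpha, \beta > 0$ and $a\ge 0$ such that, on $M$, \begin{align*} \operatorname{div}\bigl(P(\nabla f)\bigr) - \alpha \langle P(\nabla f), \nabla f\rangle + \beta f &\leq a,\\ \operatorname{div}\bigl(P(\nabla f)\bigr) &\leq a,\\ \langle P(\nabla f), \nabla f\rangle &\geq 0. \end{align*} Then: (i) $\displaystyle \int_M e^{-\alpha f}\, dv_g < +\infty.$ (ii) For every $r \geq 1$, \[ \operatorname{Vol}(D_r) \leq C\, r^{\frac{2\alpha a}{\beta}}, \] where $D_r = \left\{ x \in M: 2\sqrt{f(x)}\leq \sqrt{2\beta}\,r \right\}$ and $C = e^{\frac{\alpha \beta}{2}} \int_M e^{-\alpha f}\, dv_g$.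
   Context: $\nabla$, $\operatorname{div}$, $dv_g$ and $\operatorname{Vol}$ denote the gradient, divergence, Riemannian volume measure and volume of $(M,g)$, and $\langle\cdot,\cdot\rangle = g$. ''Symmetric'' means $\langle P(X),Y\rangle=\langle X,P(Y)\rangle$ for all tangent vectors $X,Y$ at the same point. A function $f$ is proper if preimages of compact subsets of $\mathbb{R}$ are compact. *)

(* Defs.v *)
From HB Require Import structures.
From mathcomp Require Import all_boot all_order all_algebra.
From mathcomp Require Import all_classical all_reals all_analysis.

Set Implicit Arguments.
Unset Strict Implicit.
Unset Printing Implicit Defensive.

Import Order.TTheory GRing.Theory Num.Theory.
Import numFieldNormedType.Exports.

Local Open Scope classical_set_scope.
Local Open Scope ring_scope.

(** * Lebesgue measure on R^n

    The library equips [n.-tuple T] with the product sigma-algebra but has no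
    product measure on it, so the binary product [\x] is iterated. *)

Section tuple_cons.
Variable R : realType.
Local Notation TR := (measurableTypeR R).

Definition tuple_cons n (x : TR * n.-tuple TR) : n.+1.-tuple TR :=
  [the n.+1.-tuple TR of x.1 :: x.2].

Definition tuple_uncons n (t : n.+1.-tuple TR) : TR * n.-tuple TR :=
  (thead t, [tuple of behead t]).

Lemma measurable_tuple_cons n : measurable_fun setT (@tuple_cons n).
Proof. exact: measurable_cons. Qed.

Lemma measurable_tuple_uncons n : measurable_fun setT (@tuple_uncons n).
Proof.
apply/measurable_fun_pair => /=; first exact: measurable_tnth.
exact: measurable_behead.
Qed.

Lemma tuple_consK n : cancel (@tuple_cons n) (@tuple_uncons n).
Proof.
by case=> x t; rewrite /tuple_uncons /tuple_cons theadE; congr pair; apply/val_inj.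
Qed.

End tuple_cons.

Section lebesgue_cons.
Local Open Scope ereal_scope.
Variables (R : realType) (n : nat).
Local Notation TR := (measurableTypeR R).
Variable m : {sigma_finite_measure set (n.-tuple TR) -> \bar R}.

Definition lebesgue_cons : set (n.+1.-tuple TR) -> \bar R :=
  pushforward (@lebesgue_measure R \x m) (@tuple_cons R n).

Let lebesgue_cons0 : lebesgue_cons set0 = 0.
Proof. by rewrite /lebesgue_cons /pushforward preimage_set0 measure0. Qed.

Let lebesgue_cons_ge0 A : 0 <= lebesgue_cons A.
Proof. by rewrite /lebesgue_cons /pushforward; apply: measure_ge0. Qed.

Let lebesgue_cons_sigma_additive : semi_sigma_additive lebesgue_cons.
Proof.
exact: (@measure_semi_sigma_additive _ _ _
  (measure_function_pushforward__canonical__measure_function_Measure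
    (@lebesgue_measure R \x m) (@measurable_tuple_cons R n))).
Qed.

HB.instance Definition _ := isMeasure.Build _ _ _ lebesgue_cons
  lebesgue_cons0 lebesgue_cons_ge0 lebesgue_cons_sigma_additive.

Let lebesgue_cons_sigma_finite : sigma_finite setT lebesgue_cons.
Proof.
have /sigma_finiteP[F [TF ndF Foo]] := sigma_finiteT (@lebesgue_measure R).
have /sigma_finiteP[G [TG ndG Goo]] := sigma_finiteT m.
exists (fun k => @tuple_uncons R n @^-1` (F k `*` G k)).
  rewrite -preimage_bigcup (_ : \bigcup_k _ = setT) ?preimage_setT//.
  rewrite -setXTT TF TG; apply/seteqP; split => -[x y].
    by move=> [k _ []/= ? ?]; split; exists k.
  move=> [/= [k _ Fkx] [l _ Gly]]; exists (maxn k l) => //; split.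
  - by move: x Fkx; exact/subsetPset/ndF/leq_maxl.
  - by move: y Gly; exact/subsetPset/ndG/leq_maxr.
move=> k; have [mF Fk] := Foo k; have [mG Gk] := Goo k; split.
  rewrite -[X in measurable X]setTI; apply: measurable_tuple_uncons => //.
  exact: measurableX.
rewrite /lebesgue_cons /pushforward (_ : _ @^-1` _ = F k `*` G k).
  by rewrite product_measure1E// lte_mul_pinfty// ge0_fin_numE.
by rewrite -comp_preimage (_ : _ \o _ = id)//; exact/funext/tuple_consK.
Qed.

HB.instance Definition _ :=
  Measure_isSigmaFinite.Build _ _ _ lebesgue_cons lebesgue_cons_sigma_finite.

End lebesgue_cons.

Fixpoint lebesgue_tuple (R : realType) n :
    {sigma_finite_measure set (n.-tuple (measurableTypeR R)) -> \bar R} :=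
  if n is m.+1 then lebesgue_cons (lebesgue_tuple R m)
  else \d_ ([tuple] : 0.-tuple (measurableTypeR R)).

(** * Functions of class C^k on open subsets of R^n *)

Section Ck.
Variables (R : realType) (n : nat).
Implicit Types (O : set 'rV[R]_n) (F : 'rV[R]_n -> R).

Definition partial (k : 'I_n) F (y : 'rV[R]_n) : R := 'D_(delta_mx 0 k) F y.

Fixpoint Ck_on (k : nat) O F : Prop :=
  if k is k'.+1 then
    (forall y, O y -> differentiable F y) /\
    (forall j, Ck_on k' O (partial j F))
  else forall y, O y -> {for y, continuous F}.

Definition smooth_on O F := forall k, Ck_on k O F.

End Ck.

(** * Smooth manifolds

    Manifolds without boundary, given by a smooth atlas (not necessarily
    maximal).  [chart i] and [chart_inv i] are total functions that are only
    meaningful on [chart_dom i] and on its image.  Connectedness is not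
    required. *)

Record smooth_manifold (R : realType) (n : nat) := SmoothManifold {
  carrier :> ptopologicalType ;
  carrier_hausdorff : hausdorff_space carrier ;
  carrier_second_countable : @second_countable carrier ;
  chart_index : Type ;
  chart_dom : chart_index -> set carrier ;
  chart : chart_index -> carrier -> 'rV[R]_n ;
  chart_inv : chart_index -> 'rV[R]_n -> carrier ;
  chart_dom_open : forall i, open (chart_dom i) ;
  chart_dom_cover : forall x, exists i, chart_dom i x ;
  chart_cod_open : forall i, open (chart i @` chart_dom i) ;
  chartK : forall i x, chart_dom i x -> chart_inv i (chart i x) = x ;
  chart_continuous : forall i x, chart_dom i x -> {for x, continuous (chart i)} ;
  chart_inv_continuous : forall i x, chart_dom i x ->
    {for chart i x, continuous (chart_inv i)} ;
  transition_smooth : forall i j k,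
    smooth_on (chart i @` (chart_dom i `&` chart_dom j))
              (fun y => chart j (chart_inv i y) 0 k)
}.

Arguments chart_index {R n} M : rename.
Arguments chart_dom {R n M} i : rename.
Arguments chart {R n M} i x : rename.
Arguments chart_inv {R n M} i y : rename.

Section manifold.
Variables (R : realType) (n : nat) (M : smooth_manifold R n).
Implicit Types (i j : chart_index M) (x : M).

Definition transition i j : 'rV[R]_n -> 'rV[R]_n := chart j \o chart_inv i.

Definition chart_cod i : set 'rV[R]_n := chart i @` chart_dom i.

Definition Ck_manifold (k : nat) (f : M -> R) : Prop :=
  forall i, Ck_on k (chart_cod i) (f \o chart_inv i).

(** Tensor fields are given by their components in all charts of the atlas, as
    functions of the coordinates, subject to the usual transformation laws.
    Tangent vectors are row vectors: under a change of coordinates with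
    Jacobian [J] (the transpose of the matrix of the differential) the
    components [v] become [v *m J].  A bilinear form with matrix [G] sends
    [u, v] to [u *m G *m v^T] and an endomorphism with matrix [P] sends [v] to
    [v *m P]. *)

Record riemannian_metric := RiemannianMetric {
  metric :> chart_index M -> 'rV[R]_n -> 'M[R]_n ;
  metric_smooth : forall i a b,
    smooth_on (chart_cod i) (fun y => metric i y a b) ;
  metric_sym : forall i y, chart_cod i y -> (metric i y)^T = metric i y ;
  metric_pos : forall i y (v : 'rV[R]_n), chart_cod i y -> v != 0 ->
    0 < (v *m metric i y *m v^T) 0 0 ;
  metric_change : forall i j x, chart_dom i x -> chart_dom j x ->
    let J := jacobian (transition i j) (chart i x) in
    metric i (chart i x) = J *m metric j (chart j x) *m J^T
}.

Record bundle_endomorphism := BundleEndomorphism {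
  endo :> chart_index M -> 'rV[R]_n -> 'M[R]_n ;
  endo_smooth : forall i a b,
    smooth_on (chart_cod i) (fun y => endo i y a b) ;
  endo_change : forall i j x, chart_dom i x -> chart_dom j x ->
    let J := jacobian (transition i j) (chart i x) in
    endo i (chart i x) *m J = J *m endo j (chart j x)
}.

(** Components, in each chart, of a vector field. *)
Definition vector_field := chart_index M -> 'rV[R]_n -> 'rV[R]_n.

Definition endo_apply (P : bundle_endomorphism) (X : vector_field) :
  vector_field := fun i y => X i y *m P i y.

Variable g : riemannian_metric.

Definition inner i (x : M) (u v : 'rV[R]_n) : R :=
  (u *m g i (chart i x) *m v^T) 0 0.

Definition symmetric_endo (P : bundle_endomorphism) : Prop :=
  forall i x (u v : 'rV[R]_n), chart_dom i x ->
    inner i x (u *m P i (chart i x)) v = inner i x u (v *m P i (chart i x)).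

(** [inner (grad f) v] is the differential of [f] applied to [v]. *)
Definition grad (f : M -> R) : vector_field := fun i y =>
  (\row_k partial k (f \o chart_inv i) y) *m invmx (g i y).

(** [christoffel i y k a b] is the symbol with upper index [k] and lower
    indices [a], [b] of the Levi-Civita connection. *)
Definition christoffel i (y : 'rV[R]_n) (k a b : 'I_n) : R :=
  2^-1 * \sum_l invmx (g i y) k l *
    (partial a (fun z => g i z b l) y + partial b (fun z => g i z a l) y
     - partial l (fun z => g i z a b) y).

(** Row [a] is the covariant derivative of [X] along the [a]-th coordinate
    vector field. *)
Definition covariant_derivative (X : vector_field) i (y : 'rV[R]_n) : 'M[R]_n :=
  \matrix_(a, k) (partial a (fun z => X i z 0 k) y
                  + \sum_b christoffel i y k a b * X i y 0 b).

(** The divergence of [X] is the trace of its covariant derivative.  This and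
    [inner_field] are computed in the chart [i]; at a given [x] the value does
    not depend on the chart around [x]. *)
Definition divergence (X : vector_field) i (x : M) : R :=
  \tr (covariant_derivative X i (chart i x)).

Definition inner_field (X Y : vector_field) i (x : M) : R :=
  inner i x (X i (chart i x)) (Y i (chart i x)).

(** Geodesics defined on the whole line, for the Levi-Civita connection. *)
Definition geodesic (c : R -> M) : Prop :=
  continuous c /\
  forall i t, chart_dom i (c t) ->
    let u : R -> 'rV[R]_n := chart i \o c in
    [/\ derivable u t 1, derivable (derive1 u) t 1 &
        forall k, derive1 (derive1 u) t 0 k
          + \sum_a \sum_b christoffel i (u t) k a b * derive1 u t 0 a * derive1 u t 0 b
          = 0].

(** Geodesic completeness, which for connected manifolds is metric completeness
    by the Hopf-Rinow theorem. *)
Definition complete_metric : Prop :=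
  forall i x (v : 'rV[R]_n), chart_dom i x ->
    exists c : R -> M, [/\ geodesic c, c 0 = x &
      derive1 (chart i \o c : R -> 'rV[R]_n) 0 = v].

(** The measurable subsets of [borel] are the Borel subsets of [M]. *)
Definition borel := g_sigma_algebraType (@open M).

Definition rV_of_tuple (t : n.-tuple (measurableTypeR R)) : 'rV[R]_n :=
  \row_k tnth t k.

(** In each chart, the Riemannian volume has density [sqrt (det g)]; as the
    atlas has a countable subcover this determines [mu]. *)
Definition is_riemannian_volume (mu : {measure set borel -> \bar R}) : Prop :=
  forall i (A : set borel), measurable A -> A `<=` chart_dom i ->
    mu A = (\int[lebesgue_tuple R n]_(t in rV_of_tuple @^-1` (chart i @` A))
              (Num.sqrt (\det (g i (rV_of_tuple t))))%:E)%E.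

Definition proper_map (f : M -> R) : Prop :=
  forall K : set R, compact K -> compact (f @^-1` K).

End manifold.

(* Main.v *)
(** Let [X = P grad f]. For [0 < lambda <= alpha] the first two hypotheses give
    [div X - lambda <X, grad f> <= a - (lambda/alpha) beta f]. Integrating the
    divergence of [psi(f) e^(-lambda f) X], where [psi] is a nonincreasing cutoff,
    and dropping the term in [psi'], which has a sign by the third hypothesis,
    yields
      [0 <= int psi(f) e^(-lambda f) (a - (lambda/alpha) beta f)].
    For [lambda = alpha] this bounds [int e^(-alpha f)] by the volume of a compact
    sublevel of [f]. In general it says that [lambda^mu int psi(f) e^(-lambda f)],
    with [mu = alpha a / beta], is nondecreasing in [lambda]; comparing
    [lambda = alpha / r^2] with [lambda = alpha] bounds the volume of [D_r], where
    [e^(-alpha f / r^2) >= e^(-alpha beta / 2)].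

    The divergence theorem is needed only for a vector field multiplied by a
    compactly supported [C^1] function. A partition of unity reduces it to
    charts, where Jacobi's formula turns it into the vanishing of integrals of
    partial derivatives. Since the hypotheses hold in every chart, the
    independence of [div X] from the chart is never used; only that of the
    derivative of a function along [X] is. *)

Require Import Defs.
From mathcomp Require Import all_boot all_order all_algebra.
From mathcomp Require Import all_classical all_reals all_analysis.
From mathcomp Require finmap.
From mathcomp Require Import perm measurable_realfun ring lra.
Import Order.TTheory GRing.Theory Num.Theory.
Import numFieldNormedType.Exports.
Local Open Scope classical_set_scope.
Local Open Scope ring_scope.

Set Implicit Arguments.
Unset Strict Implicit.
Unset Printing Implicit Defensive.

(** * Functions of class C^1 near a point *)

(** Nothing is known in advance about the finiteness of any weighted integral, so every identity is
    used only after truncation to a sublevel set of [f], which is compact because [f] is proper and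
    nonnegative. The level of the cutoff stays fixed while [lambda] varies.

    The exponent [mu] is forced: [lambda d/dlambda] of [lambda^mu e^(-lambda f)] produces the factor
    [mu - lambda f], and this is [alpha / beta] times [a - (lambda / alpha) beta f] exactly when
    [mu = alpha a / beta]. On [D_r] one has [f <= beta r^2 / 2], so [lambda = alpha / r^2] keeps
    [lambda f <= alpha beta / 2] whatever [r] is, and all the growth in [r] sits in
    [(alpha / lambda)^mu = r^(2 mu)]. For (ii) a single cutoff suffices: it is [1] on [D_r] and at
    most [1] elsewhere.

    Regularity is tight, since [f] of class C^2 makes [X] only C^1, and chart expressions are total
    functions that are meaningful only on the image of the chart. The calculus is therefore set up
    for germs of C^1 functions at a point. *)

Lemma near_eq_continuous (T U : topologicalType) (F G : T -> U) (x : T) :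
  (\near x, F x = G x) -> {for x, continuous F} -> {for x, continuous G}.
Proof.
move=> FG; rewrite /prop_for /continuous_at (nbhs_singleton FG).
by apply: cvg_trans; apply: near_eq_cvg; apply: filterS FG.
Qed.

Lemma continuousDR (T : topologicalType) (R : realType) (F G : T -> R) (x : T) :
  {for x, continuous F} -> {for x, continuous G} ->
  {for x, continuous (F \+ G)}.
Proof. exact: (@continuousD _ _ _ F G). Qed.

Lemma continuousMR (T : topologicalType) (R : realType) (F G : T -> R) (x : T) :
  {for x, continuous F} -> {for x, continuous G} ->
  {for x, continuous (F \* G)}.
Proof. exact: (@continuousM _ _ F G). Qed.

Lemma continuous_sumR (T : topologicalType) (R : realType) (I : Type)
    (r : seq I) (F : I -> T -> R) (x : T) :
  (forall i, {for x, continuous (F i)}) ->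
  {for x, continuous (fun t => \sum_(i <- r) F i t)}.
Proof.
move=> cF; elim: r => [|i r IH].
  rewrite (_ : (fun _ => _) = cst 0); first exact: cst_continuous.
  by apply/funext => t; rewrite big_nil.
rewrite (_ : (fun _ => _) = F i \+ (fun t => \sum_(i <- r) F i t)).
  exact: continuousDR.
by apply/funext => t; rewrite big_cons.
Qed.

(** The first-order expansion of [F] at [y] is also one for [G]; by [diff_unique] its linear part is
    the differential of [G]. *)
Lemma near_eq_differentiable (R : realType) (V W : normedModType R)
    (F G : V -> W) (y : V) :
  (\near y, F y = G y) -> differentiable F y -> differentiable G y.
Proof.
move=> FG dF; have [cdF /eqaddoP dFE] := (diff_locallyP _ _).1 dF.
have dGE : G \o shift y = cst (G y) + 'd F y +o_ 0 id.
  apply/eqaddoP => e e0; have := dFE _ e0; apply: filter_app.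
  have : \forall z \near 0, F (z + y) = G (z + y).
    by have := FG; rewrite (near_shift 0 y); apply: filterS => z /=; rewrite subr0.
  apply: filterS => z FGz; apply: le_trans; rewrite le_eqVlt; apply/orP; left.
  apply/eqP; congr (`| _ |).
  by rewrite /= !fctE /= FGz (nbhs_singleton FG).
by apply/diff_locallyP; rewrite (diff_unique cdF dGE).
Qed.

Section C1_at.
Context {R : realType} {n : nat}.
Implicit Types (F G : 'rV[R]_n -> R) (y : 'rV[R]_n).

(** Differentiability is required near [y] but continuity of the partial derivatives only at [y].
    This depends only on the germ of [F], and on an open set it amounts to [Ck_on 1]. *)
Definition C1_at F y := (\forall z \near y, differentiable F z) /\
  forall k, {for y, continuous (partial k F)}.

Lemma C1_at_diff F y : C1_at F y -> differentiable F y.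
Proof. by case=> /nbhs_singleton. Qed.

Lemma C1_at_derivable F y v : C1_at F y -> derivable F y v.
Proof. by move=> /C1_at_diff /diff_derivable. Qed.

Lemma C1_at_continuous F y : C1_at F y -> {for y, continuous F}.
Proof. by move=> /C1_at_diff /differentiable_continuous. Qed.

Lemma open_Ck1_on (O : set 'rV[R]_n) F : open O ->
  Ck_on 1 O F <-> forall y, O y -> C1_at F y.
Proof.
move=> oO; split=> [[dF cF] y Oy|CF].
  split=> [|k]; last by apply: cF.
  by near=> z; apply: dF; near: z; exact: open_nbhs_nbhs.
by split=> [y /CF/C1_at_diff //|j y /CF[_]]; apply.
Unshelve. all: end_near. Qed.

Lemma near_eq_partial F G y k : (\near y, F y = G y) ->
  \forall z \near y, partial k F z = partial k G z.
Proof.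
move=> /near_join; apply: filterS => z FG.
by rewrite /partial; apply: near_eq_derive.
Qed.

Lemma near_eq_C1_at F G y : (\near y, F y = G y) -> C1_at F y -> C1_at G y.
Proof.
move=> FG [dF cF]; split=> [|k].
  move: FG => /near_join FG; near=> z.
  by apply: (@near_eq_differentiable _ _ _ F); near: z.
by apply: near_eq_continuous (cF k); exact: near_eq_partial.
Unshelve. all: end_near. Qed.

Lemma C1_at_cst (c : R) y : C1_at (cst c) y.
Proof.
split=> [|k]; first by near=> z; exact: differentiable_cst.
rewrite (_ : partial k _ = cst 0); first exact: cst_continuous.
by apply/funext => z; rewrite /partial derive_cst.
Unshelve. all: end_near. Qed.

Lemma partial_coord k l : partial k (fun z : 'rV[R]_n => z 0 l) = cst (k == l)%:R.
Proof.
apply/funext => y; rewrite /partial -[RHS]/((k == l)%:R).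
have := @derive_mx _ _ _ _ id y (delta_mx 0 k) (@derivable_id _ _ y _).
rewrite derive_id => /matrixP /(_ 0 l); rewrite !mxE => <-.
by rewrite eqxx eq_sym.
Qed.

Lemma C1_at_coord l y : C1_at (fun z => z 0 l) y.
Proof.
split=> [|k]; last by rewrite partial_coord; exact: cst_continuous.
by near=> z; exact: differentiable_coord.
Unshelve. all: end_near. Qed.

Lemma partialD F G y k : C1_at F y -> C1_at G y ->
  partial k (F \+ G) y = partial k F y + partial k G y.
Proof. by move=> cF cG; rewrite /partial deriveD//; exact: C1_at_derivable. Qed.

Lemma partialM F G y k : C1_at F y -> C1_at G y ->
  partial k (F \* G) y = F y * partial k G y + G y * partial k F y.
Proof. by move=> cF cG; rewrite /partial deriveM//; exact: C1_at_derivable. Qed.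

Lemma C1_atD F G y : C1_at F y -> C1_at G y -> C1_at (F \+ G) y.
Proof.
move=> [dF cF] [dG cG]; split=> [|k].
  by near=> z; apply: differentiableD; near: z.
apply: (@near_eq_continuous _ _ (partial k F \+ partial k G)).
  by near=> z; rewrite /partial deriveD//; apply: diff_derivable; near: z.
by apply: continuousDR; [exact: (cF k)|exact: (cG k)].
Unshelve. all: end_near. Qed.

Lemma C1_atM F G y : C1_at F y -> C1_at G y -> C1_at (F \* G) y.
Proof.
move=> CF CG; have [[dF cF] [dG cG]] := (CF, CG); split=> [|k].
  by near=> z; apply: differentiableM; near: z.
apply: (@near_eq_continuous _ _ ((F \* partial k G) \+ (G \* partial k F))).
  by near=> z; rewrite /partial deriveM//; apply: diff_derivable; near: z.
apply: continuousDR; apply: continuousMR.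
- exact: (C1_at_continuous CF).
- exact: (cG k).
- exact: (C1_at_continuous CG).
- exact: (cF k).
Unshelve. all: end_near. Qed.

Lemma C1_atZ (c : R) F y : C1_at F y -> C1_at (fun z => c * F z) y.
Proof. by move=> CF; exact: (C1_atM (C1_at_cst c y) CF). Qed.

Lemma C1_at_sum (I : Type) (r : seq I) (P : pred I) (F : I -> 'rV[R]_n -> R) y :
  (forall i, P i -> C1_at (F i) y) -> C1_at (fun z => \sum_(i <- r | P i) F i z) y.
Proof.
move=> CF; elim: r => [|i r IH].
  rewrite (_ : (fun _ => _) = cst 0); first exact: C1_at_cst.
  by apply/funext => z; rewrite big_nil.
have [Pi|Pi] := boolP (P i).
  rewrite (_ : (fun _ => _) = F i \+ (fun z => \sum_(i <- r | P i) F i z)).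
    exact: (C1_atD (CF _ Pi)).
  by apply/funext => z; rewrite big_cons Pi.
rewrite (_ : (fun _ => _) = (fun z => \sum_(i <- r | P i) F i z))//.
by apply/funext => z; rewrite big_cons (negbTE Pi).
Qed.

Lemma partial_sum (I : Type) (r : seq I) (F : I -> 'rV[R]_n -> R) y k :
  (forall i, C1_at (F i) y) ->
  partial k (fun z => \sum_(i <- r) F i z) y = \sum_(i <- r) partial k (F i) y.
Proof.
move=> CF; elim: r => [|i r IH].
  rewrite big_nil (_ : (fun _ => _) = cst 0); first exact: derive_cst.
  by apply/funext => z; rewrite big_nil.
rewrite (_ : (fun _ => _) = F i \+ (fun z => \sum_(i <- r) F i z)).
  rewrite big_cons -IH; apply: partialD; first exact: CF.
  by apply: C1_at_sum => j _; exact: CF.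
by apply/funext => z; rewrite big_cons.
Qed.

Lemma C1_at_prod (I : Type) (r : seq I) (F : I -> 'rV[R]_n -> R) y :
  (forall i, C1_at (F i) y) -> C1_at (fun z => \prod_(i <- r) F i z) y.
Proof.
move=> CF; elim: r => [|i r IH].
  rewrite (_ : (fun _ => _) = cst 1); first exact: C1_at_cst.
  by apply/funext => z; rewrite big_nil.
rewrite (_ : (fun _ => _) = F i \* (fun z => \prod_(i <- r) F i z)).
  exact: (C1_atM (CF i)).
by apply/funext => z; rewrite big_cons.
Qed.

Lemma partial_comp (phi : R -> R) F y k :
  derivable phi (F y) 1 -> differentiable F y ->
  partial k (phi \o F) y = phi^`()%classic (F y) * partial k F y.
Proof.
move=> /derivable1_diffP dphi dF; rewrite /partial deriveE; last first.
  exact: differentiable_comp.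
rewrite diff_comp//= deriveE// diff1E// derive1E.
by rewrite mulrC.
Qed.

Lemma C1_at_comp (phi : R -> R) F y : C1_at F y ->
  (\forall s \near F y, derivable phi s 1) ->
  {for F y, continuous phi^`()%classic} ->
  C1_at (phi \o F) y.
Proof.
move=> CF dphi cphi; have [dF cF] := CF.
have cFy : {for y, continuous F} by apply: C1_at_continuous.
have {}dphi : \forall z \near y, derivable phi (F z) 1 by exact: (cFy _ dphi).
split=> [|k].
  near=> z; apply: differentiable_comp; first by near: z.
  by apply/derivable1_diffP; near: z.
apply: (@near_eq_continuous _ _ (((phi^`()%classic \o F) \* partial k F))).
  by near=> z; apply/esym/partial_comp; near: z.
apply: continuousMR; last exact: (cF k).
exact: continuous_comp.
Unshelve. all: end_near. Qed.

Lemma C1_atV F y : F y != 0 -> C1_at F y -> C1_at (fun z => (F z)^-1) y.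
Proof.
move=> Fy0 CF.
have nF0 : \forall s \near F y, s != 0.
  by apply: open_nbhs_nbhs; split; [exact: open_neq|].
apply: (@C1_at_comp (fun s => s^-1)) => //.
  by apply: filterS nF0 => s s0; exact: derivableV.
apply: (@near_eq_continuous R R (fun s : R => - s ^- 2)).
  apply: filterS nF0 => s s0.
  by rewrite derive1E deriveV// derive_id [RHS]mulr1.
apply: continuousN; apply: continuousV; first by rewrite expf_neq0.
exact: exprn_continuous.
Qed.

Lemma near_sqrtr0 F y : F y < 0 -> {for y, continuous F} ->
  \forall z \near y, cst 0 z = Num.sqrt (F z).
Proof.
move=> Fy0 cF; have nF0 : \forall s \near F y, s < 0.
  by apply: open_nbhs_nbhs; split; [exact: open_lt|].
have : \forall z \near y, F z < 0 by exact: (cF _ nF0).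
by apply: filterS => z /ltW Fz; rewrite ler0_sqrtr.
Qed.

(** Nonvanishing is enough, because [Num.sqrt] is locally the constant [0] at negative values.
    Determinants of metrics can thus be treated knowing only that they are nonzero. *)
Lemma C1_at_sqrt F y : F y != 0 -> C1_at F y -> C1_at (fun z => Num.sqrt (F z)) y.
Proof.
rewrite neq_lt => /orP[Fy0|Fy0] CF.
  apply: near_eq_C1_at (C1_at_cst 0 y).
  by apply: near_sqrtr0 => //; apply: C1_at_continuous.
have nF0 : \forall s \near F y, 0 < s.
  by apply: open_nbhs_nbhs; split; [exact: open_gt|].
apply: (@C1_at_comp Num.sqrt) => //.
  by apply: filterS nF0 => s s0; have [] := is_derive1_sqrt s0.
apply: (@near_eq_continuous R R (fun s : R => (2 * Num.sqrt s)^-1)).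
  by apply: filterS nF0 => s s0; rewrite derive1E derive_sqrt.
apply: continuousV; first by rewrite mulf_neq0// gt_eqF// sqrtr_gt0.
by apply: continuousMR; [exact: cst_continuous|exact: sqrt_continuous].
Qed.

(* Where [F] is negative, [Num.sqrt (F z)] is [0] and both sides vanish. *)
Lemma partial_sqrt F y k : F y != 0 -> C1_at F y ->
  partial k (fun z => Num.sqrt (F z)) y = (2 * Num.sqrt (F y))^-1 * partial k F y.
Proof.
rewrite neq_lt => /orP[Fy0|Fy0] CF.
  rewrite ler0_sqrtr ?ltW// mulr0 invr0 mul0r.
  have F0 : \forall z \near y, cst 0 z = Num.sqrt (F z).
    by apply: near_sqrtr0 => //; apply: C1_at_continuous.
  by rewrite -(nbhs_singleton (near_eq_partial k F0)); exact: derive_cst.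
rewrite -derive_sqrt// -derive1E; apply: partial_comp.
  by have [] := is_derive1_sqrt Fy0.
exact: C1_at_diff.
Qed.

(** The [if] inside the product makes each summand the Leibniz product of a matrix with one row
    differentiated, the shape used in [partial_det]. *)
Lemma partial_prod m (F : 'I_m -> 'rV[R]_n -> R) y k :
  (forall i, C1_at (F i) y) ->
  partial k (fun z => \prod_i F i z) y =
  \sum_i \prod_j (if j == i then partial k (F j) y else F j y).
Proof.
elim: m F => [|m IH] F CF.
  rewrite big_ord0 (_ : (fun _ => _) = cst 1); first exact: derive_cst.
  by apply/funext => z; rewrite big_ord0.
rewrite (_ : (fun _ => _) = F ord0 \* (fun z => \prod_i F (lift ord0 i) z)).
  rewrite partialM//; last by apply: C1_at_prod => i; exact: CF.
  rewrite IH; last by move=> i; exact: CF.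
  rewrite [RHS]big_ord_recl addrC; congr (_ + _).
    by rewrite [RHS]big_ord_recl eqxx mulrC.
  rewrite mulr_sumr; apply: eq_bigr => i _; rewrite big_ord_recl/=.
  by congr (_ * _); apply: eq_bigr => j _; rewrite (inj_eq (@lift_inj _ _)).
by apply/funext => z; rewrite big_ord_recl.
Qed.

Lemma C1_at_det m (A : 'rV[R]_n -> 'M[R]_m) y :
  (forall a b, C1_at (fun z => A z a b) y) -> C1_at (fun z => \det (A z)) y.
Proof.
move=> CA; apply: C1_at_sum => s _; apply: C1_atZ.
by apply: C1_at_prod => a; exact: CA.
Qed.

(* Differentiating the Leibniz formula row by row and expanding along the
   differentiated row. *)
Lemma partial_det m (A : 'rV[R]_n -> 'M[R]_m) y k :
  (forall a b, C1_at (fun z => A z a b) y) ->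
  partial k (fun z => \det (A z)) y =
  \sum_a \sum_b partial k (fun z => A z a b) y * cofactor (A y) a b.
Proof.
move=> CA; pose B a := \matrix_(b, c)
  (if b == a then partial k (fun z => A z b c) y else A y b c).
transitivity (\sum_a \det (B a)).
  rewrite partial_sum; last first.
    by move=> s; apply: C1_atZ; apply: C1_at_prod => a; exact: CA.
  rewrite exchange_big; apply: eq_bigr => s _ /=.
  have CP : C1_at (fun z => \prod_i A z i (s i)) y.
    by apply: C1_at_prod => a; exact: CA.
  rewrite (_ : partial k _ y =
      (-1) ^+ s * partial k (fun z => \prod_i A z i (s i)) y); last first.
    rewrite (@partialM (cst ((-1) ^+ s)))//; last exact: C1_at_cst.
    by rewrite [X in _ + _ * X]derive_cst mulr0 addr0.
  rewrite partial_prod; last by move=> i; exact: CA.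
  rewrite mulr_sumr; apply: eq_bigr => a _; congr (_ * _).
  by apply: eq_bigr => b _; rewrite mxE.
apply: eq_bigr => a _; rewrite (expand_det_row _ a); apply: eq_bigr => b _.
rewrite mxE eqxx; congr (_ * _); rewrite /cofactor; congr (_ * \det _).
by apply/matrixP => c d; rewrite !mxE eq_sym (negbTE (neq_lift _ _)).
Qed.

End C1_at.

(** * The chain rule for maps between coordinate spaces *)

Section C1_at_comp_rV.
Context {R : realType} {m n : nat}.
Variables (F : 'rV[R]_n -> R) (tau : 'rV[R]_m -> 'rV[R]_n) (y : 'rV[R]_m).
Hypothesis tau_C1 : forall l, C1_at (fun z => tau z 0 l) y.

(** The finitely many neighbourhoods of the coordinates are intersected, and [tau] is the sum of its
    coordinates times the basis vectors. *)
Lemma near_differentiable_rV : \forall z \near y, differentiable tau z.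
Proof.
have dtau : \forall z \near y, forall l, differentiable (fun z => tau z 0 l) z.
  exact: (@filter_forall _ _ (fun l z => differentiable (fun w => tau w 0 l) z)
    (nbhs y) _ (fun l => (tau_C1 l).1)).
apply: filterS dtau => z dtau.
have -> : tau = \sum_(l < n) (fun z => tau z 0 l *: delta_mx 0 l).
  by apply/funext => w; rewrite fct_sumE; exact: row_sum_delta.
by apply: differentiable_sum => l; exact: differentiableZl.
Qed.

Lemma jacobian_partial : differentiable tau y ->
  forall k l, jacobian tau y k l = partial k (fun z => tau z 0 l) y.
Proof.
move=> dtau k l; have := deriveEjacobian (delta_mx 0 k) dtau.
rewrite -rowE derive_mx; last exact: diff_derivable.
by move=> /matrixP /(_ 0 l); rewrite !mxE.
Qed.

Lemma partial_comp_rV k : differentiable tau y -> differentiable F (tau y) ->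
  partial k (F \o tau) y =
  \sum_l partial k (fun z => tau z 0 l) y * partial l F (tau y).
Proof.
move=> dtau dF; rewrite /partial deriveE; last exact: differentiable_comp.
rewrite diff_comp//= -(deriveE _ dtau) derive_mx; last exact: diff_derivable.
rewrite [X in 'd F _ X]row_sum_delta linear_sum; apply: eq_bigr => l _.
by rewrite linearZ -(deriveE _ dF) mxE.
Qed.

End C1_at_comp_rV.

Lemma C1_at_comp_rV {R : realType} {m n : nat} (F : 'rV[R]_n -> R)
    (tau : 'rV[R]_m -> 'rV[R]_n) (y : 'rV[R]_m) :
  (forall l, C1_at (fun z => tau z 0 l) y) -> C1_at F (tau y) ->
  C1_at (F \o tau) y.
Proof.
move=> Ctau [dF cF]; have dtau := near_differentiable_rV Ctau.
have ctau : {for y, continuous tau}.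
  by apply: differentiable_continuous; exact: (nbhs_singleton dtau).
have {}dF : \forall z \near y, differentiable F (tau z) by exact: (ctau _ dF).
split=> [|k].
  by near=> z; apply: differentiable_comp; near: z.
apply: (@near_eq_continuous _ _
  (fun z => \sum_l partial k (fun z => tau z 0 l) z * partial l F (tau z))).
  by near=> z; apply/esym/partial_comp_rV; near: z.
apply: continuous_sumR => l; apply: continuousMR; first by have [_] := Ctau l; exact.
by apply: continuous_comp => //; exact: cF.
Unshelve. all: end_near. Qed.

(** * Lebesgue measure on R^n *)

Lemma continuous_rV (T : topologicalType) (R : realType) (n : nat)
    (f : T -> 'rV[R]_n) (x : T) :
  (forall l, {for x, continuous (fun t => f t 0 l)}) -> {for x, continuous f}.
Proof.
move=> cf A [P fP PA]; apply: (@filterS _ _ _ [set t | forall i j, P i j (f t i j)]).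
  by move=> t; exact: PA.
apply: filter_forall => i; apply: filter_forall => j.
have fPj := fP i j; move: fPj; rewrite (ord1 i) => fPj; exact: (cf j _ fPj).
Qed.

Lemma open_preimage_measurable (R : realType) d (T : measurableType d)
    (D : set T) (h : T -> R) :
  (forall O : set R, open O -> measurable (D `&` h @^-1` O)) -> measurable_fun D h.
Proof.
move=> mh; apply: (measurability _ (RGenOpens.measurableE R)).
by move=> _ [_ [a [b ->] <-]]; apply: mh; exact: interval_open.
Qed.

Lemma open_setI_preimage (T U : topologicalType) (O : set T) (F : T -> U) (V : set U) :
  open O -> (forall x, O x -> {for x, continuous F}) -> open V ->
  open (O `&` F @^-1` V).
Proof.
move=> oO cF oV; rewrite openE => x [Ox VFx]; apply: filterI.
  exact: open_nbhs_nbhs.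
by apply: (cF x Ox); exact: open_nbhs_nbhs.
Qed.

(** * Open sets of row vectors and the product sigma-algebra on tuples *)

Section measurable_rV_of_tuple.
Context {R : realType} {n : nat}.
Local Notation TR := (measurableTypeR R).

(** A countable base made of product sets: cubes with rational centre and half-side
    [1 / (k + 1)]. *)
Let cube (c : 'rV[rat]_n * nat) : set (n.-tuple TR) :=
  \bigcap_(i in setT) [set t | `|tnth t i - ratr (c.1 0 i)| < c.2.+1%:R^-1 :> R].

Let measurable_cube c : measurable (cube c).
Proof.
apply: fin_bigcap_measurable => // i _.
have := @measurable_tnth _ TR n i measurableT
  _ (@measurable_ball R (ratr (c.1 0 i)) c.2.+1%:R^-1).
rewrite setTI (_ : _ @^-1` _ =
  [set t | `|tnth t i - ratr (c.1 0 i)| < c.2.+1%:R^-1 :> R])//.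
by apply/seteqP; split=> t; rewrite /= /ball/= distrC.
Qed.

(** An open set is the union of the rational cubes that it contains; there are countably many of
    them and each is measurable in the product sigma-algebra. *)
Lemma measurable_rV_of_tuple (O : set 'rV[R]_n) :
  open O -> measurable (@rV_of_tuple R n @^-1` O).
Proof.
move=> oO; pose C := [set c | cube c `<=` @rV_of_tuple R n @^-1` O].
rewrite (_ : _ @^-1` O = \bigcup_c (if `[< C c >] then cube c else set0)).
  apply: countable_bigcupT_measurable => [|c]; first exact: countableP.
  by case: ifP.
apply/seteqP; split=> [t Ot|t [c _]]; last by case: asboolP => // Cc /Cc.
have /nbhs_ballP[r /= r0 rO] : nbhs (rV_of_tuple t) O by exact: open_nbhs_nbhs.
(* Half the radius, because two points of the same cube are compared through its centre. *)
have [k kr] : exists k, k.+1%:R^-1 < r / 2.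
  have [k _ /(_ k (leqnn _))/= ?] :=
    near_infty_natSinv_lt (PosNum (divr_gt0 r0 (ltr0n R 2))).
  by exists k.
have [q qP] : exists q : 'I_n -> rat,
    forall i, `|tnth t i - ratr (q i)| < k.+1%:R^-1 :> R.
  suff /choice[q qP] : forall i, exists q : rat, `|tnth t i - ratr q| < k.+1%:R^-1 :> R.
    by exists q.
  move=> i.
  have [|q] := @rat_in_itvoo R (tnth t i - k.+1%:R^-1) (tnth t i).
    by rewrite gtrBl invr_gt0.
  rewrite in_itv/= => /andP[q1 q2]; exists q.
  by rewrite ger0_norm ?subr_ge0 ?(ltW q2)// ltrBlDl -ltrBlDr.
exists (\row_i q i, k) => //; case: asboolP => [_ i _ /=|]; first by rewrite mxE.
case=> s /= cs; apply: rO; split=> // a b; rewrite ord1 !mxE /ball/=.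
have := cs b I; rewrite /= mxE => sb.
rewrite (le_lt_trans (ler_distD (ratr (q b)) _ _))// (splitr r) ltrD//.
  exact: lt_trans kr.
by rewrite distrC; exact: lt_trans kr.
Qed.

Lemma measurable_continuous_rV_of_tuple (O : set 'rV[R]_n) (F : 'rV[R]_n -> R) :
  open O -> (forall y, O y -> {for y, continuous F}) ->
  measurable_fun (@rV_of_tuple R n @^-1` O) (F \o @rV_of_tuple R n).
Proof.
move=> oO cF; apply: open_preimage_measurable => V oV.
exact: (measurable_rV_of_tuple (open_setI_preimage oO cF oV)).
Qed.

End measurable_rV_of_tuple.

Section lebesgue_tuple.
Context {R : realType}.
Local Notation TR := (measurableTypeR R).
Local Open Scope ereal_scope.

Definition tuple_box n (B : R) : set (n.-tuple TR) :=
  [set t | forall i, `|tnth t i| <= B]%R.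

Lemma measurable_tuple_box n B : measurable (@tuple_box n B).
Proof.
rewrite [X in measurable X](_ : _ =
    \bigcap_(i in setT) ((fun t => tnth t i) @^-1` `[(- B)%R, B%R]%classic)).
  apply: fin_bigcap_measurable => // i _.
  have := @measurable_tnth _ TR n i measurableT _ (measurable_itv `[- B, B]%R).
  by rewrite setTI.
apply/seteqP; split=> [t tB i _ /=|t tB i]; first by rewrite in_itv/= -ler_norml.
by have := tB i I; rewrite /= in_itv/= -ler_norml.
Qed.

Lemma lebesgue_tuple_box_lty n B : lebesgue_tuple R n (@tuple_box n B) < +oo.
Proof.
elim: n => [|n IH].
  by rewrite /= diracE ltry.
rewrite /= /lebesgue_cons /pushforward.
rewrite [X in (_ \x _) X](_ : _ = `[(- B)%R, B%R]%classic `*` @tuple_box n B).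
  rewrite product_measure1E; [|exact: measurable_itv|exact: measurable_tuple_box].
  have leb : (lebesgue_measure `[(- B)%R, B%R]%classic : \bar R) \is a fin_num.
    by rewrite lebesgue_measure_itv/=; case: ifP.
  apply: lte_mul_pinfty; [exact: measure_ge0|exact: leb|exact: IH].
apply/seteqP; split=> -[x t] /=.
  move=> xtB; split; first by have := xtB ord0; rewrite /= in_itv/= -ler_norml.
  by move=> i; have := xtB (lift ord0 i); rewrite tnthS.
rewrite in_itv/= -ler_norml => -[xB tB] i.
by case: (unliftP ord0 i) => [j ->|->]; rewrite ?tnthS.
Qed.

End lebesgue_tuple.

(** * Compactly supported functions on R^n and integrals of their partial derivatives *)

Section integral_partial.
Context {R : realType}.
Local Notation TR := (measurableTypeR R).

Lemma bounded_support_integrable d (T : measurableType d)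
    (mu : {measure set T -> \bar R}) (D : set T) (h : T -> R) (C : R) :
  measurable D -> (mu D < +oo)%E -> measurable_fun setT h ->
  (forall t, `|h t| <= C) -> (forall t, ~ D t -> h t = 0) ->
  mu.-integrable setT (EFin \o h).
Proof.
move=> mD muD mh hC h0.
have -> : EFin \o h = (EFin \o h) \_ D.
  apply/funext => t; rewrite /patch; case: ifPn => //=.
  by move=> /negP; rewrite inE => /h0 ->.
apply: (integrable_mkcond _ mD).1.
apply: (@measurable_bounded_integrable _ _ _ mu h D) => //.
  exact: measurable_funTS.
exists C; split; first exact: num_real.
by move=> x Cx t _; apply: (le_trans (hC t)); exact: ltW.
Qed.

Lemma continuous_support_bounded n (F : 'rV[R]_n -> R) (B : R) :
  continuous F -> (forall y : 'rV[R]_n, (exists l, B < `|y 0 l|) -> F y = 0) ->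
  exists C, forall y, `|F y| <= C.
Proof.
move=> cF F0; pose K := [set y : 'rV[R]_n | forall l, `|y 0 l| <= B].
have cK : compact K.
  rewrite (_ : K = [set v : 'rV[R]_n | forall l, `[- B, B]%classic (v 0 l)]).
    apply: (@rV_compact R n (fun=> `[- B, B]%classic)) => l.
    exact: segment_compact.
  by apply/seteqP; split=> v Kv l; have := Kv l; rewrite /= in_itv/= ler_norml.
(* The extreme value theorem needs a nonempty box; if the box is empty, which can happen for
   negative [B], then [F] vanishes identically. *)
have [[y Ky]|K0] := pselect (K !=set0); last first.
  exists 0 => y; rewrite F0 ?normr0//.
  apply: contrapT => /forallNP yB; apply: K0; exists y => l.
  by rewrite leNgt; apply/negP; exact: yB.
have [c _ cmax] : exists2 c, c \in K & forall t, t \in K -> `|F t| <= `|F c|.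
  apply: (@compact_EVT_max _ _ (fun t => `|F t|)) => //; first by exists y.
  apply: continuous_subspaceT => t.
  by apply: (@continuous_comp _ _ _ F); [exact: cF|exact: norm_continuous].
exists `|F c| => t; have [/mem_set/cmax //|Kt] := pselect (K t).
rewrite (F0 t) ?normr0//.
apply: contrapT => /forallNP yB; apply: Kt => l.
by rewrite leNgt; apply/negP; exact: yB.
Qed.

Lemma continuous_support_integrable n (F : 'rV[R]_n -> R) (B : R) :
  continuous F -> (forall y : 'rV[R]_n, (exists l, B < `|y 0 l|) -> F y = 0) ->
  (lebesgue_tuple R n).-integrable setT (fun t => (F (rV_of_tuple t))%:E).
Proof.
move=> cF F0; have [C FC] := continuous_support_bounded cF F0.
apply: (@bounded_support_integrable _ _ _ (@tuple_box R n B) _ C) => //.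
- exact: measurable_tuple_box.
- exact: lebesgue_tuple_box_lty.
- rewrite -(preimage_setT (@rV_of_tuple R n)).
  apply: measurable_continuous_rV_of_tuple => [|y _]; first exact: openT.
  exact: cF.
- move=> t tB; apply: F0; apply: contrapT => /forallNP yB; apply: tB => l.
  by have := yB l; rewrite mxE => /negP; rewrite -leNgt.
Qed.

(** The counterpart of [tuple_cons] for row vectors, through which a function on R^(n+1) is sliced
    along its first coordinate. *)
Definition rV_cons n (x : R) (y : 'rV[R]_n) : 'rV[R]_n.+1 :=
  \row_l oapp (fun j => y 0 j) x (unlift ord0 l).

Lemma rV_cons0 n x (y : 'rV[R]_n) : rV_cons x y 0 ord0 = x.
Proof. by rewrite mxE unlift_none. Qed.

Lemma rV_consS n x (y : 'rV[R]_n) l : rV_cons x y 0 (lift ord0 l) = y 0 l.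
Proof. by rewrite mxE liftK. Qed.

Lemma rV_of_tuple_cons n (x : TR) (t : n.-tuple TR) :
  rV_of_tuple (tuple_cons (x, t)) = rV_cons x (rV_of_tuple t).
Proof.
apply/rowP => l; rewrite mxE; case: (unliftP ord0 l) => [j ->|->].
  by rewrite rV_consS mxE tnthS.
by rewrite rV_cons0.
Qed.

Lemma continuous_rV_consl n (y : 'rV[R]_n) : continuous (fun x => rV_cons x y).
Proof.
move=> x; apply: continuous_rV => l; case: (unliftP ord0 l) => [j ->|->].
  rewrite (_ : (fun _ => _) = cst (y 0 j)); first exact: cst_continuous.
  by apply/funext => z; rewrite rV_consS.
rewrite (_ : (fun _ => _) = id)//.
by apply/funext => z; rewrite rV_cons0.
Qed.

Lemma continuous_rV_consr n (x : R) : continuous (@rV_cons n x).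
Proof.
move=> y; apply: continuous_rV => l; case: (unliftP ord0 l) => [j ->|->].
  rewrite (_ : (fun _ => _) = (fun z : 'rV[R]_n => z 0 j)).
    exact: coord_continuous.
  by apply/funext => z; rewrite rV_consS.
rewrite (_ : (fun _ => _) = cst x); first exact: cst_continuous.
by apply/funext => z; rewrite rV_cons0.
Qed.

Lemma rV_cons_shiftl n (h x : R) (y : 'rV[R]_n) :
  rV_cons (h + x) y = h *: delta_mx 0 ord0 + rV_cons x y.
Proof.
apply/rowP => l; rewrite [RHS]mxE; case: (unliftP ord0 l) => [j ->|->].
  by rewrite !rV_consS !mxE eqxx /= mulr0 add0r.
by rewrite !rV_cons0 !mxE eqxx mulr1.
Qed.

Lemma rV_cons_shiftr n (h x : R) l (y : 'rV[R]_n) :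
  rV_cons x (h *: delta_mx 0 l + y) = h *: delta_mx 0 (lift ord0 l) + rV_cons x y.
Proof.
apply/rowP => j; rewrite [RHS]mxE; case: (unliftP ord0 j) => [i ->|->].
  by rewrite !rV_consS !mxE (inj_eq (@lift_inj _ _)).
by rewrite !rV_cons0 !mxE /= mulr0 add0r.
Qed.

Lemma is_derive_rV_consl n (F : 'rV[R]_n.+1 -> R) (d : R) x y :
  is_derive (rV_cons x y) (delta_mx 0 ord0) F d ->
  is_derive x 1 (fun x => F (rV_cons x y)) d.
Proof.
move=> [dF <-].
have E : (fun h : R => h^-1 *: (((fun x => F (rV_cons x y)) \o shift x) (h *: 1)
      - F (rV_cons x y))) =
    (fun h => h^-1 *: ((F \o shift (rV_cons x y)) (h *: delta_mx 0 ord0)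
      - F (rV_cons x y))).
  by apply/funext => h /=; rewrite [h *: 1]mulr1 rV_cons_shiftl.
by apply: DeriveDef; rewrite /derivable /derive E.
Qed.

Lemma is_derive_rV_consr n (F : 'rV[R]_n.+1 -> R) (d : R) x l y :
  is_derive (rV_cons x y) (delta_mx 0 (lift ord0 l)) F d ->
  is_derive y (delta_mx 0 l) (fun y => F (rV_cons x y)) d.
Proof.
move=> [dF <-].
have E : (fun h : R => h^-1 *:
      (((fun y => F (rV_cons x y)) \o shift y) (h *: delta_mx 0 l) - F (rV_cons x y))) =
    (fun h => h^-1 *: ((F \o shift (rV_cons x y)) (h *: delta_mx 0 (lift ord0 l))
      - F (rV_cons x y))).
  by apply/funext => h /=; rewrite rV_cons_shiftr.
by apply: DeriveDef; rewrite /derivable /derive E.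
Qed.

Lemma integral_derive_eq0 (F G : R -> R) (B : R) :
  continuous G -> (forall x, is_derive x (1 : R) F (G x)) ->
  (forall x, B < `|x| -> F x = 0) -> (forall x, B < `|x| -> G x = 0) ->
  (\int[lebesgue_measure]_x (G x)%:E = 0)%E.
Proof.
(* This choice makes the interval nondegenerate and puts both of its endpoints strictly outside the
   support, so that the boundary terms vanish. *)
move=> cG FG F0 G0; pose B' := `|B| + 1.
have B'0 : 0 < B' by rewrite /B' ltr_wpDl.
have BB' : B < B' by rewrite /B' (le_lt_trans (ler_norm B))// ltrDl.
transitivity (\int[lebesgue_measure]_(x in `[(- B')%R, B'%R]) (G x)%:E)%E.
  rewrite [RHS]integral_mkcond; apply: eq_integral => x _; rewrite /patch.
  case: ifPn => //; rewrite notin_setE /= in_itv/= -ler_norml => /negP.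
  by rewrite -ltNge => xB; rewrite G0// (lt_trans BB').
rewrite (@continuous_FTC2 _ G F).
- by rewrite !F0 ?subee// ?normrN gtr0_norm.
- by rewrite gtrN.
- exact: continuous_subspaceT.
- split=> [x _| |].
  + by have [] := FG x.
  + apply: cvg_at_right_filter; apply: differentiable_continuous.
    by apply/derivable1_diffP; have [] := FG (- B').
  + apply: cvg_at_left_filter; apply: differentiable_continuous.
    by apply/derivable1_diffP; have [] := FG B'.
- by move=> x _; rewrite derive1E; have [] := FG x.
Qed.

(** Integrability of the composite comes from the nonnegative change of variables applied to the
    absolute value of [h]. *)
Lemma integral_pushforward_comp d1 d2 (X : measurableType d1)
    (Y : measurableType d2) (phi : X -> Y) (mphi : measurable_fun setT phi)
    (mu : {measure set X -> \bar R}) (h : Y -> \bar R) :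
  (pushforward mu phi).-integrable setT h ->
  mu.-integrable setT (h \o phi) /\
  (\int[pushforward mu phi]_y h y = \int[mu]_x h (phi x))%E.
Proof.
move=> /integrableP[mh ih].
have ihc : mu.-integrable setT (h \o phi).
  apply/integrableP; split; first exact: measurableT_comp.
  apply: le_lt_trans ih; rewrite ge0_integral_pushforward//.
  exact: measurableT_comp.
by split=> //; rewrite integral_pushforward.
Qed.

Lemma integral_lebesgue_cons n (h : n.+1.-tuple TR -> \bar R) :
  (lebesgue_tuple R n.+1).-integrable setT h ->
  (lebesgue_measure \x lebesgue_tuple R n)%E.-integrable setT
    (h \o @tuple_cons R n) /\
  (\int[lebesgue_tuple R n.+1]_t h t =
   \int[lebesgue_measure \x lebesgue_tuple R n]_z h (tuple_cons z))%E.
Proof. exact: (integral_pushforward_comp (@measurable_tuple_cons R n)). Qed.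

(** Induction on the dimension through Fubini. [F] and its derivative [G] are kept apart, with a
    derivative in the single direction [k], so that every slice satisfies the same hypotheses. *)
Lemma integral_partial_eq0 n k (F G : 'rV[R]_n -> R) (B : R) :
  continuous G -> (forall y, is_derive y (delta_mx 0 k) F (G y)) ->
  (forall y : 'rV[R]_n, (exists l, B < `|y 0 l|) -> F y = 0) ->
  (forall y : 'rV[R]_n, (exists l, B < `|y 0 l|) -> G y = 0) ->
  (\int[lebesgue_tuple R n]_t (G (rV_of_tuple t))%:E = 0)%E.
Proof.
elim: n k F G => [[]//|n IH] k F G cG FG F0 G0.
have [iG ->] := integral_lebesgue_cons (continuous_support_integrable cG G0).
(* The inner integral is the one containing the differentiated coordinate: over the tail by
   induction, or over the head by the fundamental theorem of calculus. *)
case: (unliftP ord0 k) => [l|] kE; rewrite {}kE in FG.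
  rewrite -integral12_prod_meas1//; apply: integral0_eq => x _.
  rewrite /fubini_F; under eq_integral do rewrite /= rV_of_tuple_cons.
  apply: (IH l (fun y => F (rV_cons x y)) (fun y => G (rV_cons x y))).
  - by move=> y; apply: continuous_comp; [exact: continuous_rV_consr|exact: cG].
  - by move=> y; exact: is_derive_rV_consr.
  - by move=> y [j yj]; apply: F0; exists (lift ord0 j); rewrite rV_consS.
  - by move=> y [j yj]; apply: G0; exists (lift ord0 j); rewrite rV_consS.
rewrite -integral21_prod_meas1//; apply: integral0_eq => t _.
rewrite /fubini_G; under eq_integral do rewrite /= rV_of_tuple_cons.
set y := rV_of_tuple t.
apply: (@integral_derive_eq0 (fun x => F (rV_cons x y)) (fun x => G (rV_cons x y)) B).
- by move=> x; apply: continuous_comp; [exact: continuous_rV_consl|exact: cG].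
- by move=> x; exact: is_derive_rV_consl.
- by move=> x xB; apply: F0; exists ord0; rewrite rV_cons0.
- by move=> x xB; apply: G0; exists ord0; rewrite rV_cons0.
Qed.

End integral_partial.

(** * The divergence in a chart *)

Section chart_divergence.
Context {R : realType} {n : nat} {M : smooth_manifold R n}.
Variables (g : riemannian_metric M) (i : chart_index M).
Implicit Types (y : 'rV[R]_n).

Lemma chart_cod_C1_at (F : 'rV[R]_n -> R) y :
  Ck_on 1 (chart_cod i) F -> chart_cod i y -> C1_at F y.
Proof. by move=> /(open_Ck1_on _ (@chart_cod_open R n M i)); apply. Qed.

Lemma near_chart_cod y : chart_cod i y -> \forall z \near y, chart_cod i z.
Proof. by move=> iy; apply: open_nbhs_nbhs; split=> //; exact: chart_cod_open. Qed.

Lemma C1_at_metric a b y : chart_cod i y -> C1_at (fun z => g i z a b) y.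
Proof. by apply: chart_cod_C1_at; exact: (metric_smooth g i a b 1). Qed.

Lemma metric_det_neq0 y : chart_cod i y -> \det (g i y) != 0.
Proof.
move=> iy; apply/det0P => -[v v0 vg].
by have := metric_pos g iy v0; rewrite vg mul0mx mxE ltxx.
Qed.

Lemma metric_unitmx y : chart_cod i y -> g i y \in unitmx.
Proof. by move=> iy; rewrite unitmxE unitfE metric_det_neq0. Qed.

Lemma invmx_metricE y a b : chart_cod i y ->
  invmx (g i y) a b = (\det (g i y))^-1 * cofactor (g i y) b a.
Proof. by move=> iy; rewrite /invmx metric_unitmx// !mxE. Qed.

Lemma invmx_metric_sym y : chart_cod i y -> (invmx (g i y))^T = invmx (g i y).
Proof. by move=> iy; rewrite trmx_inv (Defs.metric_sym g iy). Qed.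

Lemma C1_at_metric_det y : chart_cod i y -> C1_at (fun z => \det (g i z)) y.
Proof. by move=> iy; apply: C1_at_det => a b; exact: C1_at_metric. Qed.

Lemma C1_at_invmx_metric a b y : chart_cod i y ->
  C1_at (fun z => invmx (g i z) a b) y.
Proof.
move=> iy; apply: (@near_eq_C1_at _ _
  (fun z => (\det (g i z))^-1 * cofactor (g i z) b a)).
  by apply: filterS (near_chart_cod iy) => z iz; rewrite invmx_metricE.
apply: C1_atM.
  by apply: C1_atV; [exact: metric_det_neq0|exact: C1_at_metric_det].
apply: C1_atZ; apply: C1_at_det => c d.
rewrite (_ : (fun _ => _) = (fun z => g i z (lift b c) (lift a d))).
  exact: C1_at_metric.
by apply/funext => z; rewrite !mxE.
Qed.

Definition volume_density y := Num.sqrt (\det (g i y)).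

Lemma C1_at_volume_density y : chart_cod i y -> C1_at volume_density y.
Proof.
by move=> iy; apply: C1_at_sqrt; [exact: metric_det_neq0|exact: C1_at_metric_det].
Qed.

(** Jacobi's formula: the cofactors in [partial_det] are [det g] times the entries of the inverse,
    and the chain rule for the square root leaves half the trace of [g^-1 dg]. *)
Lemma partial_volume_density k y : chart_cod i y ->
  partial k volume_density y = volume_density y *
    (2^-1 * \sum_a \sum_b invmx (g i y) a b * partial k (fun z => g i z a b) y).
Proof.
move=> iy; rewrite /volume_density partial_sqrt; last 2 first.
- exact: metric_det_neq0.
- exact: C1_at_metric_det.
rewrite partial_det; last by move=> a b; exact: C1_at_metric.
set S := \sum_a \sum_b invmx _ _ _ * _.
rewrite (_ : \sum_a _ = \det (g i y) * S); last first.
  rewrite mulr_sumr; apply: eq_bigr => a _; rewrite mulr_sumr.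
  apply: eq_bigr => b _; rewrite -[in RHS](invmx_metric_sym iy) mxE.
  by rewrite invmx_metricE// mulrC !mulrA divff ?metric_det_neq0// mul1r.
have [d0|d0] := leP (\det (g i y)) 0.
  by rewrite ler0_sqrtr// mulr0 invr0 !mul0r.
have s0 : Num.sqrt (\det (g i y)) != 0 by rewrite gt_eqF// sqrtr_gt0.
rewrite -{2}(sqr_sqrtr (ltW d0)).
by field.
Qed.

(** In the trace, the first and third terms of the Christoffel symbol are exchanged by swapping [a]
    and [l], so they cancel by symmetry of the inverse metric. *)
Lemma christoffel_trace b y : chart_cod i y ->
  \sum_a christoffel g i y a a b =
  2^-1 * \sum_a \sum_l invmx (g i y) a l * partial b (fun z => g i z a l) y.
Proof.
move=> iy; rewrite /christoffel -mulr_sumr; congr (_ * _).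
pose T c d e := partial c (fun z => g i z d e) y.
have TC c d e : T c d e = T c e d.
  have : \forall z \near y, g i z d e = g i z e d.
    apply: filterS (near_chart_cod iy) => z iz.
    by rewrite -[in LHS](Defs.metric_sym g iz) mxE.
  by move=> /(near_eq_partial c)/nbhs_singleton.
have invC c d : invmx (g i y) c d = invmx (g i y) d c.
  by rewrite -[in LHS](invmx_metric_sym iy) mxE.
(* The same double sum is added to both sides, and its indices are swapped on the left only; the
   identity then holds term by term. *)
rewrite -[LHS](@addrK _ (\sum_a \sum_l invmx (g i y) a l * T a b l)).
apply/eqP; rewrite subr_eq [X in _ + X == _]exchange_big -!big_split /=.
apply/eqP; apply: eq_bigr => a _; rewrite -!big_split /=; apply: eq_bigr => l _.
rewrite -/(T a b l) -/(T b a l) -/(T l a b) -/(T b a l) (TC l a b) (invC l a).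
by ring.
Qed.

Lemma divergence_coord (X : vector_field M) x : chart_dom i x ->
  let y := chart i x in
  divergence g X i x = \sum_a partial a (fun z => X i z 0 a) y
    + 2^-1 * \sum_b X i y 0 b *
        \sum_a \sum_l invmx (g i y) a l * partial b (fun z => g i z a l) y.
Proof.
move=> ix y; have iy : chart_cod i y by exists x.
rewrite /divergence /mxtrace -/y.
under eq_bigr do rewrite mxE.
rewrite big_split /=; congr (_ + _).
rewrite exchange_big mulr_sumr; apply: eq_bigr => b _ /=.
by rewrite -mulr_suml christoffel_trace// mulrC mulrCA.
Qed.

(** The Christoffel contribution to the divergence and the logarithmic derivative of the density are
    the same half trace. Hence the density turns [div (u X)] into a Euclidean divergence. *)
Lemma weighted_divergence_coord (X : vector_field M) (u : 'rV[R]_n -> R) x :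
  chart_dom i x -> let y := chart i x in
  C1_at u y -> (forall k, C1_at (fun z => X i z 0 k) y) ->
  \sum_k partial k (fun z => u z * X i z 0 k * volume_density z) y =
  (u y * divergence g X i x + \sum_k X i y 0 k * partial k u y) * volume_density y.
Proof.
move=> ix y Cu CX; have iy : chart_cod i y by exists x.
have CuX k : C1_at (u \* (fun z => X i z 0 k)) y by exact: C1_atM.
under eq_bigr => k _.
  rewrite (@partialM _ _ (u \* (fun z => X i z 0 k)) volume_density); last 2 first.
  - exact: CuX.
  - exact: C1_at_volume_density.
  rewrite (partialM _ Cu (CX k)) (partial_volume_density _ iy).
  over.
rewrite divergence_coord// -/y mulrDl mulrDr mulrDl !mulr_sumr !mulr_suml.
rewrite -!big_split /=; apply: eq_bigr => k _.
set S := \sum_a _; by ring.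
Qed.

End chart_divergence.

(** * The Riemannian volume in a chart *)

Section integral_density.
Local Open Scope ereal_scope.
Context d1 d2 (X : measurableType d1) (Y : measurableType d2) (R : realType).
Variables (mu : {measure set X -> \bar R}) (nu : {measure set Y -> \bar R}).
Variables (D : set X) (E : set Y) (Psi : X -> Y) (rho : X -> R).
Hypotheses (mD : measurable D) (mE : measurable E) (mPsi : measurable_fun D Psi).
Hypotheses (mrho : measurable_fun D rho) (rho0 : forall x, (0 <= rho x)%R).
Hypothesis nuE : forall A, measurable A ->
  nu (A `&` E) = \int[mu]_(x in D `&` Psi @^-1` A) (rho x)%:E.

Import HBNNSimple.

Let mcomp (h : Y -> \bar R) : measurable_fun setT h ->
  measurable_fun D (fun x => h (Psi x) * (rho x)%:E).
Proof.
move=> mh; apply: emeasurable_funM; last exact/measurable_EFinP.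
exact: (measurable_comp measurableT _ mh mPsi).
Qed.

Let integral_density_nnsfun (h : {nnsfun Y >-> R}) :
  \int[nu]_(y in E) (h y)%:E = \int[mu]_(x in D) ((h (Psi x))%:E * (rho x)%:E).
Proof.
have mind r : measurable_fun setT (fun y => (r * \1_(h @^-1` [set r]) y)%:E).
  by apply/measurable_EFinP; exact: measurable_funM.
transitivity (\int[nu]_(y in E)
    (\sum_(r \in range h) (r * \1_(h @^-1` [set r]) y)%:E)).
  by apply: eq_integral => y _; rewrite fimfunE -fsumEFin.
rewrite ge0_integral_fsum//; last 2 first.
  - by move=> r; exact: measurable_funTS.
  - by move=> r y _; exact: nnfun_muleindic_ge0.
transitivity (\int[mu]_(x in D) (\sum_(r \in range h)
    ((r * \1_(h @^-1` [set r]) (Psi x))%:E * (rho x)%:E))); last first.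
  apply: eq_integral => x _; rewrite -ge0_mule_fsuml => [|r]; last first.
    exact: nnfun_muleindic_ge0.
  by rewrite fsumEFin// -(fimfunE _ (Psi x)).
rewrite ge0_integral_fsum//; last 2 first.
  - by move=> r; exact: (mcomp (mind r)).
  - by move=> r x _; apply: mule_ge0; [exact: nnfun_muleindic_ge0|rewrite lee_fin].
apply: eq_fsbigr => r /[!inE] -[y _ hy].
have r0 : (0 <= r)%R by rewrite -hy.
under eq_integral do rewrite EFinM.
rewrite integralZl_indic_nnsfun// integral_indic// nuE//.
under [RHS]eq_integral do rewrite EFinM -muleA.
rewrite ge0_integralZl//; last first.
- by move=> x _; rewrite mule_ge0 ?lee_fin.
- apply: (mcomp (h := fun y => (\1_(h @^-1` [set r]) y)%:E)).
  exact/measurable_EFinP.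
congr (_ * _); rewrite integral_mkcondr; apply: eq_integral => x _.
by rewrite epatch_indic muleC.
Qed.

(** Monotone convergence on both sides, along simple functions increasing to [h]. *)
Lemma ge0_integral_density (h : Y -> \bar R) :
  (forall y, 0 <= h y) -> measurable_fun setT h ->
  \int[nu]_(y in E) h y = \int[mu]_(x in D) (h (Psi x) * (rho x)%:E).
Proof.
move=> h0 mh; pose u := nnsfun_approx measurableT mh.
have uh y : (u n y)%:E @[n --> \oo] --> h y.
  by apply: cvg_nnsfun_approx => // ? _; exact: h0.
transitivity (limn (fun n => \int[nu]_(y in E) (u n y)%:E)).
  rewrite -monotone_convergence//.
  - by apply: eq_integral => y _; apply/esym/cvg_lim.
  - by move=> n; apply/measurable_EFinP; exact: measurable_funTS.
  - by move=> n y _; rewrite lee_fin.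
  - by move=> y _ a b ab; rewrite lee_fin; exact/lefP/nd_nnsfun_approx.
under eq_fun do rewrite integral_density_nnsfun.
rewrite -monotone_convergence//.
- apply: eq_integral => x _; apply/cvg_lim => //.
  by apply: cvgeZr => //; exact: uh.
- by move=> n; apply: (mcomp (h := fun y => (u n y)%:E)); exact/measurable_EFinP.
- by move=> n x _; rewrite mule_ge0 ?lee_fin.
- move=> x _ a b ab; rewrite lee_wpmul2r ?lee_fin//.
  exact/lefP/nd_nnsfun_approx.
Qed.

Lemma integral_density (h : Y -> R) : measurable_fun setT h ->
  \int[nu]_(y in E) (h y)%:E = \int[mu]_(x in D) (h (Psi x) * rho x)%:E.
Proof.
move=> mh; rewrite integralE [RHS]integralE.
have mh' : measurable_fun setT (EFin \o h) by exact/measurable_EFinP.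
(* Multiplication by a nonnegative density commutes with taking positive and negative parts. *)
congr (_ - _).
  rewrite ge0_integral_density//; last exact: measurable_funepos.
  apply: eq_integral => x _; rewrite !funeposE.
  by rewrite -!EFin_max -EFinM maxr_pMl// mul0r.
rewrite ge0_integral_density//; last exact: measurable_funeneg.
apply: eq_integral => x _; rewrite !funenegE.
by rewrite -!EFin_max -EFinM maxr_pMl// mul0r mulNr.
Qed.

End integral_density.

(** * Extension by zero of a function with compact support in an open set *)

Section patch_compact_support.
Context {R : realType} {n : nat}.
Variables (O L : set 'rV[R]_n) (F : 'rV[R]_n -> R).
Hypotheses (oO : open O) (cL : compact L) (LO : L `<=` O).
Hypothesis F0 : forall y, O y -> ~ L y -> F y = 0.

Lemma patch_open_near y : O y -> \forall z \near y, F z = (F \_ O) z.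
Proof.
move=> Oy; have : \forall z \near y, O z by exact: open_nbhs_nbhs.
by apply: filterS => z Oz; rewrite patchE mem_set.
Qed.

Lemma patch_support y : ~ L y -> (F \_ O) y = 0.
Proof.
by move=> Ly; rewrite patchE; case: ifPn => // /[!inE] Oy; exact: F0.
Qed.

Lemma patch_compact_near0 y : ~ L y -> \forall z \near y, cst 0 z = (F \_ O) z.
Proof.
move=> Ly; have : \forall z \near y, (~` L) z.
  apply: open_nbhs_nbhs; split=> //.
  by apply: closed_openC; apply: compact_closed => //; exact: norm_hausdorff.
by apply: filterS => z Lz; rewrite patch_support.
Qed.

Lemma partial_patch0 k y : ~ L y -> partial k (F \_ O) y = 0.
Proof.
move=> Ly; rewrite -(nbhs_singleton (near_eq_partial k (patch_compact_near0 Ly))).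
exact: derive_cst.
Qed.

(** A point lies in [O] or off the closed set [L]; near it the extension agrees with [F] in the
    first case and with [0] in the second. The C^1 version rests on the same dichotomy. *)
Lemma continuous_patch :
  (forall y, O y -> {for y, continuous F}) -> continuous (F \_ O).
Proof.
move=> cF y; have [Oy|Oy] := pselect (O y).
  exact: near_eq_continuous (patch_open_near Oy) (cF y Oy).
apply: (near_eq_continuous (patch_compact_near0 (contra_not (@LO y) Oy))).
exact: cst_continuous.
Qed.

Lemma C1_at_patch :
  (forall y, O y -> C1_at F y) -> forall y, C1_at (F \_ O) y.
Proof.
move=> cF y; have [Oy|Oy] := pselect (O y).
  exact: near_eq_C1_at (patch_open_near Oy) (cF y Oy).
by apply: (near_eq_C1_at (patch_compact_near0 (contra_not (@LO y) Oy))); exact: C1_at_cst.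
Qed.

Lemma partial_patch k : partial k (F \_ O) = (partial k F) \_ O.
Proof.
apply/funext => y; rewrite [RHS]patchE; case: ifPn => [/[!inE] Oy|/negP].
  by rewrite -(nbhs_singleton (near_eq_partial k (patch_open_near Oy))).
by rewrite inE => Oy; apply: partial_patch0 => /LO.
Qed.

Lemma compact_rV_bounded : exists B : R,
  forall y : 'rV[R]_n, (exists l, B < `|y 0 l|) -> ~ L y.
Proof.
have [B [_ LB]] := compact_bounded cL.
exists (B + 1) => y [l yl] Ly.
have : `|y| <= B + 1 by apply: (LB (B + 1) _ y Ly); rewrite ltrDl.
rewrite leNgt => /negP; apply; apply: lt_le_trans yl _.
rewrite [leRHS]/Num.Def.normr/= mx_normrE.
exact: (le_bigmax _ (fun i => `|y i.1 i.2|) (0, l)).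
Qed.

End patch_compact_support.

Section integral_partial_patch.
Context {R : realType} {n : nat}.
Variables (O L : set 'rV[R]_n) (F : 'rV[R]_n -> R).
Hypotheses (oO : open O) (cL : compact L) (LO : L `<=` O).
Hypothesis F0 : forall y, O y -> ~ L y -> F y = 0.

Lemma integrable_patch : (forall y, O y -> {for y, continuous F}) ->
  (lebesgue_tuple R n).-integrable setT
    (fun t => ((F \_ O) (rV_of_tuple t))%:E).
Proof.
move=> cF; have [B LB] := compact_rV_bounded cL.
apply: (@continuous_support_integrable _ _ _ B).
  exact: (continuous_patch oO cL LO F0).
by move=> y /LB; exact: patch_support.
Qed.

Lemma integrable_partial_patch k : (forall y, O y -> C1_at F y) ->
  (lebesgue_tuple R n).-integrable setT
    (fun t => ((partial k F \_ O) (rV_of_tuple t))%:E).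
Proof.
move=> cF; have [B LB] := compact_rV_bounded cL.
rewrite -(partial_patch oO cL LO F0).
apply: (@continuous_support_integrable _ _ _ B).
  by move=> y; have [_] := C1_at_patch oO cL LO F0 cF y; exact.
by move=> y /LB; exact: (partial_patch0 cL F0).
Qed.

Lemma integral_partial_patch_eq0 k : (forall y, O y -> C1_at F y) ->
  (\int[lebesgue_tuple R n]_t ((partial k F \_ O) (rV_of_tuple t))%:E = 0)%E.
Proof.
move=> cF; have [B LB] := compact_rV_bounded cL.
have cFO := C1_at_patch oO cL LO F0 cF.
rewrite -(partial_patch oO cL LO F0).
apply: (@integral_partial_eq0 _ _ k (F \_ O) _ B).
- by move=> y; have [_] := cFO y; exact.
- by move=> y; apply/derivableP; exact: C1_at_derivable.
- by move=> y /LB; exact: patch_support.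
- by move=> y /LB; exact: (partial_patch0 cL F0).
Qed.
End integral_partial_patch.

(** * Charts and functions supported in a chart domain *)

Section chart_topology.
Context {R : realType} {n : nat} {M : smooth_manifold R n}.
Variable i : chart_index M.

Lemma chart_cod_dom y : chart_cod i y -> chart_dom i (chart_inv i y).
Proof. by move=> [x ix <-]; rewrite chartK. Qed.

Lemma chart_invK y : chart_cod i y -> chart i (chart_inv i y) = y.
Proof. by move=> [x ix <-]; rewrite chartK. Qed.

Lemma chart_inv_cod_continuous y : chart_cod i y ->
  {for y, continuous (chart_inv i)}.
Proof. by move=> [x ix <-]; exact: chart_inv_continuous. Qed.

Lemma near_chart_dom x : chart_dom i x -> \forall z \near x, chart_dom i z.
Proof. by move=> ix; apply: open_nbhs_nbhs; split=> //; exact: chart_dom_open. Qed.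

Section chart_support.
Variables (K : set M) (w : M -> R).
Hypotheses (cK : compact K) (Ki : K `<=` chart_dom i).
Hypothesis w0 : forall x, ~ K x -> w x = 0.

(** The Hausdorff axiom enters here: compact sets are closed, so a function supported in one
    vanishes near every point outside it. *)
Lemma compact_near0 x : ~ K x -> \forall z \near x, w z = 0.
Proof.
move=> Kx; have : \forall z \near x, (~` K) z.
  apply: open_nbhs_nbhs; split=> //; apply: closed_openC.
  by apply: compact_closed => //; exact: carrier_hausdorff.
by apply: filterS => z; exact: w0.
Qed.

Lemma compact_chart_image : compact (chart i @` K).
Proof.
apply: continuous_compact => //; apply: continuous_in_subspaceT => x.
by rewrite inE => /Ki; exact: chart_continuous.
Qed.

Lemma chart_image_sub : chart i @` K `<=` chart_cod i.
Proof. by move=> _ [x Kx <-]; exists x => //; exact: Ki. Qed.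

Lemma chart_image0 y : chart_cod i y -> ~ (chart i @` K) y -> w (chart_inv i y) = 0.
Proof.
by move=> iy Ky; apply: w0 => Kxy; apply: Ky; exists (chart_inv i y) => //;
  exact: chart_invK.
Qed.

Lemma continuous_chart_support :
  (forall y, chart_cod i y -> {for y, continuous (w \o chart_inv i)}) ->
  continuous w.
Proof.
move=> cw x; have [ix|ix] := pselect (chart_dom i x); last first.
  apply: (@near_eq_continuous _ _ (cst 0)); last exact: cst_continuous.
  by apply: filterS (compact_near0 (contra_not (@Ki x) ix)) => z ->.
apply: (@near_eq_continuous _ _ ((w \o chart_inv i) \o chart i)).
  by apply: filterS (near_chart_dom ix) => z iz /=; rewrite chartK.
apply: continuous_comp; first exact: chart_continuous.
by apply: cw; exists x.
Qed.

End chart_support.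
End chart_topology.

(** * Integration against the Riemannian volume in a chart *)

Section chart_volume.
Context {R : realType} {n : nat} {M : smooth_manifold R n}.
Variables (g : riemannian_metric M) (vol : {measure set (borel M) -> \bar R}).
Hypothesis vol_g : is_riemannian_volume g vol.
Variable i : chart_index M.

Let O := @rV_of_tuple R n @^-1` chart_cod i.
Let Psi (t : n.-tuple (measurableTypeR R)) : borel M := chart_inv i (rV_of_tuple t).

Lemma measurable_chart_dom : measurable (chart_dom i : set (borel M)).
Proof. by apply: sub_sigma_algebra; exact: chart_dom_open. Qed.

Let mO : measurable O.
Proof. by apply: measurable_rV_of_tuple; exact: chart_cod_open. Qed.

Let mPsi : measurable_fun O Psi.
Proof.
apply: (@measurability _ _ _ (borel M) O Psi (@open M)) => // _ [A oA <-].
apply: (measurable_rV_of_tuple (open_setI_preimage _ _ oA)).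
  exact: chart_cod_open.
by move=> y; exact: chart_inv_cod_continuous.
Qed.

Let mdensity : measurable_fun O (volume_density g i \o @rV_of_tuple R n).
Proof.
apply: measurable_continuous_rV_of_tuple; first exact: chart_cod_open.
by move=> y iy; apply: C1_at_continuous; exact: C1_at_volume_density.
Qed.

(** The definition of the volume in the form that [integral_density] expects, with the image under
    the chart rewritten as a preimage under its inverse. *)
Let vol_chart (A : set (borel M)) : measurable A ->
  vol (A `&` chart_dom i) = (\int[lebesgue_tuple R n]_(t in O `&` Psi @^-1` A)
    (volume_density g i (rV_of_tuple t))%:E)%E.
Proof.
move=> mA; rewrite (@vol_g i); last 2 first.
- by apply: measurableI => //; exact: measurable_chart_dom.
- exact: subIsetr.
congr (integral _ _ _); apply/seteqP; split=> t /=.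
  move=> [x [Ax ix] xt]; split; first by exists x.
  by rewrite /= /Psi -xt chartK.
move=> [it At]; exists (Psi t); last exact: chart_invK.
by split=> //; exact: chart_cod_dom.
Qed.

Lemma integral_vol_chart (w : M -> R) :
  measurable_fun [set: borel M] w -> (forall x, ~ chart_dom i x -> w x = 0) ->
  (\int[vol]_x (w x)%:E = \int[lebesgue_tuple R n]_t
    ((((w \o chart_inv i) \* volume_density g i) \_ (chart_cod i)) (rV_of_tuple t))%:E)%E.
Proof.
move=> mw w0; transitivity (\int[vol]_(x in (chart_dom i : set (borel M))) (w x)%:E)%E.
  rewrite [RHS]integral_mkcond; apply: eq_integral => x _; rewrite patchE.
  by case: ifPn => // /negP; rewrite inE => /w0 ->.
rewrite (integral_density (mu := lebesgue_tuple R n) (Psi := Psi)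
  (rho := volume_density g i \o @rV_of_tuple R n) mO)//.
- rewrite integral_mkcond; apply: eq_integral => t _; rewrite !patchE.
  have [it|it] := boolP (t \in O).
    by rewrite mem_set//; move: it; rewrite inE.
  by rewrite memNset//; move=> it'; move/negP: it; apply; rewrite inE.
- exact: measurable_chart_dom.
- by move=> t; exact: sqrtr_ge0.
Qed.

Lemma continuous_borel_measurable (w : M -> R) :
  continuous w -> measurable_fun [set: borel M] w.
Proof.
move=> /continuousP cw; apply: open_preimage_measurable => U oU.
by rewrite setTI; apply: sub_sigma_algebra; exact: cw.
Qed.

Section chart_compact_support.
Variables (K : set M) (w : M -> R).
Hypotheses (cK : compact K) (Ki : K `<=` chart_dom i).
Hypothesis w0 : forall x, ~ K x -> w x = 0.
Hypothesis cw : forall y, chart_cod i y -> {for y, continuous (w \o chart_inv i)}.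

Lemma integrable_chart : (lebesgue_tuple R n).-integrable setT
  (fun t => ((((w \o chart_inv i) \* volume_density g i) \_ (chart_cod i))
    (rV_of_tuple t))%:E).
Proof.
apply: (@integrable_patch _ _ _ (chart i @` K)).
- exact: chart_cod_open.
- exact: compact_chart_image.
- exact: chart_image_sub.
- by move=> y iy Ky /=; rewrite (chart_image0 w0 iy Ky) mul0r.
- move=> y iy; apply: continuousMR; first exact: cw.
  by apply: C1_at_continuous; exact: C1_at_volume_density.
Qed.

End chart_compact_support.

(** The absolute value of [w] is transported to the chart, where it is continuous with compact
    support. *)
Lemma integrable_vol_chart (K : set M) (w : M -> R) :
  compact K -> K `<=` chart_dom i -> (forall x, ~ K x -> w x = 0) ->
  (forall y, chart_cod i y -> {for y, continuous (w \o chart_inv i)}) ->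
  vol.-integrable setT (EFin \o w).
Proof.
move=> cK Ki w0 cw; have cwM := continuous_chart_support cK Ki w0 cw.
have mw := continuous_borel_measurable cwM.
have nw0 x : ~ K x -> `|w x| = 0 by move=> /w0 ->; rewrite normr0.
apply/integrableP; split; first exact/measurable_EFinP.
rewrite (_ : (fun x => _) = (fun x => `|w x|%:E)); last by apply/funext.
rewrite (@integral_vol_chart (fun x => `|w x|)); last 2 first.
- exact: measurableT_comp.
- by move=> x ix; apply: nw0 => /Ki.
apply: integral_fune_lt_pinfty => //.
apply: (@integrable_chart K (fun x => `|w x|) cK Ki nw0) => y iy.
by apply: (@continuous_comp _ _ _ (w \o chart_inv i)); [exact: cw|exact: norm_continuous].
Qed.

End chart_volume.

(** * The divergence theorem in one chart *)

Section chart_divergence_theorem.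
Context {R : realType} {n : nat} {M : smooth_manifold R n}.
Variables (g : riemannian_metric M) (vol : {measure set (borel M) -> \bar R}).
Hypothesis vol_g : is_riemannian_volume g vol.
Variables (i : chart_index M) (X : vector_field M) (K : set M) (u : M -> R).
Hypothesis CX : forall k y, chart_cod i y -> C1_at (fun z => X i z 0 k) y.
Hypotheses (cK : compact K) (Ki : K `<=` chart_dom i).
Hypothesis u0 : forall x, ~ K x -> u x = 0.
Hypothesis Cu : forall y, chart_cod i y -> C1_at (u \o chart_inv i) y.

(** The derivative of [u] along [X], written without the metric; [inner_fieldE] identifies it with
    [<X, grad u>]. *)
Definition chart_lie_derivative (X : vector_field M) (u : M -> R) i (x : M) : R :=
  \sum_k X i (chart i x) 0 k * partial k (u \o chart_inv i) (chart i x).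

(** This is [div (u X)] expanded by the product rule in chart [i] and extended by zero. *)
Definition chart_div_scaled : M -> R :=
  (fun x => u x * divergence g X i x + chart_lie_derivative X u i x) \_ (chart_dom i).

Lemma chart_lie_derivative0 x : chart_dom i x -> ~ K x ->
  chart_lie_derivative X u i x = 0.
Proof.
move=> ix Kx; rewrite /chart_lie_derivative big1// => k _.
rewrite -(nbhs_singleton (near_eq_partial k (F := cst 0) _)); last first.
  have cix : {for chart i x, continuous (chart_inv i)} by exact: chart_inv_continuous.
  have near_u0 : nbhs (chart_inv i (chart i x)) [set z | u z = 0].
    by rewrite chartK//; exact: (compact_near0 cK u0 Kx).
  have : \forall z \near chart i x, u (chart_inv i z) = 0 by exact: (cix _ near_u0).
  by apply: filterS => z /= ->.
by rewrite /partial derive_cst mulr0.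
Qed.

Let W0 x : ~ K x -> chart_div_scaled x = 0.
Proof.
move=> Kx; rewrite /chart_div_scaled patchE; case: ifPn => // /[!inE] ix.
by rewrite u0// mul0r add0r chart_lie_derivative0.
Qed.

Let WE y : chart_cod i y -> chart_div_scaled (chart_inv i y) * volume_density g i y =
  \sum_k partial k (fun z => (u \o chart_inv i) z * X i z 0 k * volume_density g i z) y.
Proof.
move=> [x ix <-]; have iy : chart_cod i (chart i x) by exists x.
rewrite weighted_divergence_coord//; [|exact: Cu|by move=> k; exact: CX].
by rewrite chartK// /chart_div_scaled patchE mem_set//= chartK.
Qed.

Let cW y : chart_cod i y -> {for y, continuous (chart_div_scaled \o chart_inv i)}.
Proof.
move=> iy; apply: (@near_eq_continuous _ _ (fun z =>
  (u \o chart_inv i) z * (\sum_a partial a (fun z => X i z 0 a) z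
    + 2^-1 * \sum_b X i z 0 b *
      \sum_a \sum_l invmx (g i z) a l * partial b (fun z => g i z a l) z)
  + \sum_k X i z 0 k * partial k (u \o chart_inv i) z)).
  apply: filterS (near_chart_cod iy) => _ [x ix <-].
  by rewrite /= chartK// /chart_div_scaled patchE mem_set// divergence_coord// chartK.
have cX k : {for y, continuous (fun z => X i z 0 k)}.
  by apply: C1_at_continuous; exact: CX.
apply: continuousDR; last first.
  apply: continuous_sumR => k; apply: continuousMR; first exact: cX.
  by have [_] := Cu iy; exact.
apply: continuousMR; first by apply: C1_at_continuous; exact: Cu.
apply: continuousDR.
  by apply: continuous_sumR => k; have [_] := CX k iy; exact.
apply: continuousMR; first exact: cst_continuous.
apply: continuous_sumR => b; apply: continuousMR; first exact: cX.
apply: continuous_sumR => a; apply: continuous_sumR => l; apply: continuousMR.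
  by apply: C1_at_continuous; exact: C1_at_invmx_metric.
by have [_] := C1_at_metric g a l iy; exact.
Qed.

Lemma integrable_div_scaled : vol.-integrable setT (EFin \o chart_div_scaled).
Proof. exact: (integrable_vol_chart vol_g cK Ki W0 cW). Qed.

(** In coordinates the integrand is a sum of partial derivatives of [u X^k sqrt(det g)], which has
    compact support in the image of the chart. *)
Lemma integral_div_scaled_eq0 : (\int[vol]_x (chart_div_scaled x)%:E = 0)%E.
Proof.
rewrite (integral_vol_chart (i := i) vol_g); last 2 first.
- by apply: continuous_borel_measurable; apply: (continuous_chart_support cK Ki W0 cW).
- by move=> x ix; rewrite W0// => /Ki.
pose F k z := (u \o chart_inv i) z * X i z 0 k * volume_density g i z.
have CF k y : chart_cod i y -> C1_at (F k) y.
  move=> iy; apply: C1_atM; last exact: C1_at_volume_density.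
  by apply: C1_atM; [exact: Cu|exact: CX].
have F0 k y : chart_cod i y -> ~ (chart i @` K) y -> F k y = 0.
  by move=> iy Ky; rewrite /F /= (chart_image0 u0 iy Ky) !mul0r.
transitivity (\int[lebesgue_tuple R n]_t \sum_k
    ((partial k (F k) \_ (chart_cod i)) (rV_of_tuple t))%:E)%E.
  apply: eq_integral => t _; rewrite sumEFin patchE; congr EFin.
  case: ifPn => [it|it]; last first.
    by rewrite big1// => k _; rewrite patchE (negbTE it).
  rewrite /= (WE (set_mem it)); apply: eq_bigr => k _.
  by rewrite patchE it.
rewrite integral_sum//; last first.
  move=> k; apply: (@integrable_partial_patch _ _ _ (chart i @` K)).
  - exact: chart_cod_open.
  - exact: compact_chart_image.
  - exact: chart_image_sub.
  - exact: F0.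
  - exact: CF.
apply: big1 => k _.
apply: (integral_partial_patch_eq0 (L := chart i @` K)).
- exact: chart_cod_open.
- exact: compact_chart_image.
- exact: chart_image_sub.
- exact: F0.
- exact: CF.
Qed.

End chart_divergence_theorem.

(** * Partitions of unity *)

Section smoothstep.
Context {R : realType}.
Implicit Types t : R.

(* [smoothstep] is a [C^1] transition from [0] on [t <= 0] to [1] on [1 <= t]. *)
Definition sq_pos t := (Num.max 0 t) ^+ 2.
Definition smoothstep t := 1 - sq_pos (1 - sq_pos t).

Lemma continuous_pos_part : continuous (fun t : R => Num.max 0 t).
Proof.
move=> t; apply: (@continuous_max _ _ (cst 0) id); first exact: cst_continuous.
by move=> ?.
Qed.

Lemma is_derive_sq_pos t : is_derive t (1 : R) sq_pos (2 * Num.max 0 t).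
Proof.
have [t0|t0|<-] := ltgtP 0 t.
- have E : \forall s \near t, s ^+ 2 = sq_pos s.
    have : \forall s \near t, 0 < s by apply: open_nbhs_nbhs; split; [exact: open_gt|].
    by apply: filterS => s s0; rewrite /sq_pos max_r// ltW.
  apply: near_eq_is_derive E _.
  have := is_deriveM (is_derive_id t (1 : R)) (is_derive_id t 1).
  rewrite (_ : _ + _ = 2 * t); last by rewrite [_ *: _]mulr1 mulr_natl.
  by congr is_derive; apply/funext => s /=; rewrite expr2.
- have E : \forall s \near t, cst 0 s = sq_pos s.
    have : \forall s \near t, s < 0 by apply: open_nbhs_nbhs; split; [exact: open_lt|].
    by apply: filterS => s s0; rewrite /sq_pos max_l ?ltW// expr0n.
  by apply: near_eq_is_derive E _; rewrite mulr0; exact: is_derive_cst.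
(* At the origin, where the two branches meet, the difference quotient is either [0] or [h]. *)
have sq_pos_cvg : (fun h : R => h^-1 *: ((sq_pos \o shift 0) (h *: 1) - sq_pos 0))
    @ 0^' --> (0 : R).
  apply/cvgrPdist_le => e e0; near=> h.
  rewrite /= addr0 [_ *: 1]mulr1 /sq_pos maxxx expr0n subr0 sub0r normrN.
  have h0 : h != 0 by near: h; exact: nbhs_dnbhs_neq.
  have he : `|h| <= e.
    near: h; apply: nbhs_dnbhs; apply: filterS (nbhs0_le e0) => //.
  have [hp|hn] := leP h 0; first by rewrite expr0n scaler0 normr0 ltW.
  by rewrite [_ *: _](_ : _ = h)//; rewrite /GRing.scale/= expr2 mulrA mulVf// mul1r.
rewrite mulr0; apply: DeriveDef; first by apply/cvg_ex; exists 0.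
exact: cvg_lim.
Unshelve. all: end_near. Qed.

Lemma sq_pos_ge0 t : 0 <= sq_pos t. Proof. exact: sqr_ge0. Qed.

Lemma le_sq_pos : {homo sq_pos : s t / s <= t}.
Proof.
move=> s t st; have pos x : 0 <= Num.max 0 x :> R by rewrite le_max lexx.
rewrite /sq_pos ler_sqr ?nnegrE//.
by rewrite ge_max pos/= le_max st orbT.
Qed.

Lemma smoothstep_le0 t : t <= 0 -> smoothstep t = 0.
Proof.
move=> t0; rewrite /smoothstep [sq_pos t](_ : _ = 0); last first.
  by rewrite /sq_pos max_l// expr0n.
by rewrite subr0 /sq_pos max_r// expr1n subrr.
Qed.

Lemma smoothstep_ge1 t : 1 <= t -> smoothstep t = 1.
Proof.
move=> t1; rewrite /smoothstep {1}/sq_pos max_l ?expr0n ?subr0//.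
rewrite subr_le0 /sq_pos max_r ?(le_trans ler01)//.
by rewrite expr_ge1// (le_trans ler01).
Qed.

Lemma le_smoothstep : {homo smoothstep : s t / s <= t}.
Proof. by move=> s t st; rewrite lerB// le_sq_pos// lerB// le_sq_pos. Qed.

Lemma smoothstep_ge0 t : 0 <= smoothstep t.
Proof.
have [t0|/ltW t0] := leP t 0; first by rewrite smoothstep_le0.
by rewrite -(smoothstep_le0 (lexx 0)) le_smoothstep.
Qed.

Lemma smoothstep_le1 t : smoothstep t <= 1.
Proof. by rewrite /smoothstep gerBl sq_pos_ge0. Qed.

Definition smoothstep' t := 2 * Num.max 0 (1 - sq_pos t) * (2 * Num.max 0 t).

Lemma is_derive_smoothstep t : is_derive t (1 : R) smoothstep (smoothstep' t).
Proof.
have dp s : derivable sq_pos s 1 by have [] := is_derive_sq_pos s.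
have d1p : is_derive t (1 : R) (fun s => 1 - sq_pos s) (- (2 * Num.max 0 t)).
  have := is_deriveB (is_derive_cst (1 : R) t 1) (is_derive_sq_pos t).
  by rewrite sub0r.
have dcomp : is_derive t (1 : R) (sq_pos \o (fun s => 1 - sq_pos s))
    (2 * Num.max 0 (1 - sq_pos t) * - (2 * Num.max 0 t)).
  have [dd _] := d1p.
  apply: DeriveDef.
    apply/derivable1_diffP; apply: differentiable_comp; apply/derivable1_diffP.
      exact: dd.
    exact: dp.
  rewrite -derive1E derive1_comp; [|exact: dd|exact: dp].
  rewrite !derive1E; have [_ ->] := d1p.
  by have [_ ->] := is_derive_sq_pos (1 - sq_pos t).
have := is_deriveB (is_derive_cst (1 : R) t 1) dcomp.
by rewrite sub0r mulrN opprK.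
Qed.

Lemma smoothstep'_ge0 t : 0 <= smoothstep' t.
Proof. by rewrite /smoothstep' !mulr_ge0// le_max lexx. Qed.

Lemma continuous_sq_pos : continuous sq_pos.
Proof.
move=> t; apply: differentiable_continuous; apply/derivable1_diffP.
by have [] := is_derive_sq_pos t.
Qed.

Lemma continuous_smoothstep' : continuous smoothstep'.
Proof.
move=> t.
have c2 (F : R -> R) : {for t, continuous F} -> {for t, continuous (fun s => 2 * F s)}.
  by move=> cF; exact: (@continuousMR _ _ (cst 2) F t (@cst_continuous _ _ _ _) cF).
apply: (@continuousMR _ _ (fun t => 2 * Num.max 0 (1 - sq_pos t))
  (fun t => 2 * Num.max 0 t)).
  apply: c2; apply: (@continuous_comp _ _ _ (fun t => 1 - sq_pos t)
    (fun t => Num.max 0 t)); last exact: continuous_pos_part.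
  apply: (@continuousDR _ _ (cst 1) (fun s => - sq_pos s)).
    exact: cst_continuous.
  by apply: continuousN; exact: continuous_sq_pos.
by apply: c2; exact: continuous_pos_part.
Qed.

End smoothstep.

Lemma C1_at_comp_derive (R : realType) (n : nat) (phi dphi : R -> R)
    (F : 'rV[R]_n -> R) y :
  (forall s, is_derive s (1 : R) phi (dphi s)) -> continuous dphi ->
  C1_at F y -> C1_at (phi \o F) y.
Proof.
move=> phiE cphi CF; apply: C1_at_comp => //.
  by near=> s; have [] := phiE s.
rewrite (_ : phi^`()%classic = dphi); first exact: cphi.
by apply/funext => s; rewrite derive1E; have [] := phiE s.
Unshelve. all: end_near. Qed.

(** * C^1 functions on the manifold, bump functions and partitions of unity *)

Section C1_manifold.
Context {R : realType} {n : nat} {M : smooth_manifold R n}.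
Implicit Types (u v : M -> R).

Definition C1_manifold u := forall i y, chart_cod i y -> C1_at (u \o chart_inv i) y.

Lemma C1_manifoldM u v : C1_manifold u -> C1_manifold v -> C1_manifold (u \* v).
Proof. by move=> Cu Cv i y iy; apply: C1_atM; [exact: Cu|exact: Cv]. Qed.

Lemma C1_manifold_onem u : C1_manifold u -> C1_manifold (fun x => 1 - u x).
Proof.
move=> Cu i y iy.
rewrite (_ : _ \o _ = cst 1 \+ (fun z => -1 * (u \o chart_inv i) z)).
  by apply: C1_atD; [exact: C1_at_cst|apply: C1_atZ; exact: Cu].
by apply/funext => z /=; rewrite mulN1r.
Qed.

Lemma C1_manifold_prod N (u : nat -> M -> R) : (forall k, C1_manifold (u k)) ->
  C1_manifold (fun x => \prod_(k < N) u k x).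
Proof. by move=> Cu i y iy; apply: C1_at_prod => k; exact: Cu. Qed.

Lemma C1_manifold_continuous u : C1_manifold u -> continuous u.
Proof.
move=> Cu x; have [i ix] := chart_dom_cover x.
apply: (@near_eq_continuous _ _ ((u \o chart_inv i) \o chart i)).
  by apply: filterS (near_chart_dom ix) => z iz /=; rewrite chartK.
apply: continuous_comp; first exact: chart_continuous.
by apply: C1_at_continuous; apply: Cu; exists x.
Qed.

Lemma open_chart_overlap (i j : chart_index M) :
  open (chart i @` (chart_dom i `&` chart_dom j)).
Proof.
rewrite (_ : _ @` _ = chart_cod i `&` chart_inv i @^-1` chart_dom j).
  apply: open_setI_preimage; first exact: chart_cod_open.
    by move=> y; exact: chart_inv_cod_continuous.
  exact: chart_dom_open.
apply/seteqP; split=> [_ [x [ix jx] <-]|y [iy jy]].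
  by split; [exists x|rewrite /= chartK].
by exists (chart_inv i y); [split=> //; exact: chart_cod_dom|exact: chart_invK].
Qed.

Lemma C1_at_transition (i j : chart_index M) x l :
  chart_dom i x -> chart_dom j x ->
  C1_at (fun y => transition i j y 0 l) (chart i x).
Proof.
move=> ix jx; have := transition_smooth i j l 1.
move=> /(open_Ck1_on _ (@open_chart_overlap i j)); apply.
by exists x.
Qed.

Lemma near_transition (i j : chart_index M) u x :
  chart_dom i x -> chart_dom j x ->
  \forall z \near chart i x,
    ((u \o chart_inv j) \o transition i j) z = (u \o chart_inv i) z.
Proof.
move=> ix jx.
have : \forall z \near chart i x, (chart i @` (chart_dom i `&` chart_dom j)) z.
  by apply: open_nbhs_nbhs; split; [exact: open_chart_overlap|exists x].
by apply: filterS => _ [z [iz jz] <-]; rewrite /= /transition /= !chartK.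
Qed.

(** In another chart, points of the overlap are handled by the transition map and the chain rule; at
    the others [w] vanishes nearby, since [K] is closed. *)
Lemma C1_manifold_chart (i : chart_index M) (K : set M) w :
  compact K -> K `<=` chart_dom i -> (forall x, ~ K x -> w x = 0) ->
  (forall y, chart_cod i y -> C1_at (w \o chart_inv i) y) -> C1_manifold w.
Proof.
move=> cK Ki w0 Cw j _ [x jx <-]; have [ix|ix] := pselect (chart_dom i x).
  apply: near_eq_C1_at (near_transition w jx ix) _.
  apply: C1_at_comp_rV => [l|]; first exact: C1_at_transition.
  by rewrite /transition /= chartK//; apply: Cw; exists x.
apply: near_eq_C1_at (C1_at_cst 0 _).
have cjx : {for chart j x, continuous (chart_inv j)} by exact: chart_inv_continuous.
have near_w0 : nbhs (chart_inv j (chart j x)) [set z | w z = 0].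
  by rewrite chartK//; apply: (compact_near0 cK w0) => /Ki.
have : \forall z \near chart j x, w (chart_inv j z) = 0 by exact: (cjx _ near_w0).
by apply: filterS => z /= ->.
Qed.

Lemma bump_function (x : M) : exists (i : chart_index M) (K : set M) (w : M -> R),
  [/\ compact K, K `<=` chart_dom i, forall z, ~ K z -> w z = 0, C1_manifold w &
    (forall z, 0 <= w z <= 1) /\ \forall z \near x, w z = 1].
Proof.
have [i ix] := chart_dom_cover x; pose c := chart i x.
have [r /= r0 rO] : exists2 r : R, 0 < r & ball c r `<=` chart_cod i.
  have : \forall z \near c, chart_cod i z by apply: near_chart_cod; exists x.
  by move=> /nbhs_ballP[r r0 rO]; exists r.
pose rho := r / 2.
have rho0 : 0 < rho by rewrite divr_gt0.
pose L := [set y : 'rV[R]_n | forall l, `[c 0 l - rho, c 0 l + rho]%classic (y 0 l)].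
have LP y l : L y -> `|y 0 l - c 0 l| <= rho.
  by move=> /(_ l); rewrite /= in_itv/= ler_distl.
have cL : compact L.
  apply: (@rV_compact R n (fun l => `[c 0 l - rho, c 0 l + rho]%classic)) => l.
  exact: segment_compact.
have LO : L `<=` chart_cod i.
  move=> y Ly; apply: rO; split=> // a b; rewrite ord1 /ball/= distrC.
  by rewrite (le_lt_trans (LP _ b Ly))// /rho ltr_pdivrMr// ltr_pMr// ltr1n.
(* The squared Euclidean distance is used because it is C^1. Leaving the cube [L] in one coordinate
   forces [N >= rho^2], hence [Q <= 0], while [Q] equals [2] at the centre and so exceeds [1] near
   it. *)
pose N (y : 'rV[R]_n) := \sum_l (y 0 l - c 0 l) ^+ 2.
pose Q (y : 'rV[R]_n) := 2 - 2 * rho ^- 2 * N y.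
have CN y : C1_at N y.
  apply: C1_at_sum => l _.
  have Cl : C1_at (fun z : 'rV[R]_n => z 0 l - c 0 l) y.
    exact: (C1_atD (C1_at_coord l y) (C1_at_cst (- c 0 l) y)).
  exact: (C1_atM Cl Cl).
have CQ y : C1_at Q y.
  rewrite (_ : Q = cst 2 \+ (fun z => (- (2 * rho ^- 2)) * N z)).
    by apply: C1_atD; [exact: C1_at_cst|exact: C1_atZ].
  by apply/funext => z; rewrite /Q /= mulNr.
pose K := chart_inv i @` L.
have cK : compact K.
  apply: continuous_compact => //; apply: continuous_in_subspaceT => y.
  by rewrite inE => /LO; exact: chart_inv_cod_continuous.
have Ki : K `<=` chart_dom i by move=> _ [y /LO iy <-]; exact: chart_cod_dom.
pose w := (smoothstep \o Q \o chart i) \_ (chart_dom i).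
have w0 z : ~ K z -> w z = 0.
  move=> Kz; rewrite /w patchE; case: ifPn => // /[!inE] iz.
  apply: smoothstep_le0; rewrite /Q.
  have [l] : exists l, ~ `[c 0 l - rho, c 0 l + rho]%classic (chart i z 0 l).
    by apply/existsNP => Lz; apply: Kz; exists (chart i z) => //; rewrite chartK.
  rewrite /= in_itv/= -ler_distl => /negP; rewrite -ltNge => rl.
  have : rho ^+ 2 <= N (chart i z).
    rewrite /N (bigD1 l)//= -[X in X <= _]addr0 lerD//.
      by rewrite -(real_normK (num_real (_ - _))) ler_sqr ?nnegrE// ltW.
    by apply: sumr_ge0 => k _; exact: sqr_ge0.
  by move=> rN; rewrite subr_le0 -mulrA ler_peMr// ler_pdivlMl ?exprn_gt0// mulr1.
have wi y : chart_cod i y -> (w \o chart_inv i) y = (smoothstep \o Q) y.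
  by move=> [z iz <-]; rewrite /= /w patchE chartK// mem_set.
exists i, K, w; split=> //.
  apply: (C1_manifold_chart cK Ki w0) => y iy.
  apply: (@near_eq_C1_at _ _ (smoothstep \o Q)).
    by apply: filterS (near_chart_cod iy) => z iz; rewrite wi.
  exact: C1_at_comp_derive is_derive_smoothstep continuous_smoothstep' (CQ y).
split=> [z|].
  rewrite /w patchE; case: ifP => _; last by rewrite lexx ler01.
  by rewrite smoothstep_ge0 smoothstep_le1.
have Q1 : \forall y \near c, 1 < Q y.
  have Qc : 1 < Q c.
    rewrite /Q /N big1 ?mulr0 ?subr0 ?ltr1n// => l _.
    by rewrite subrr expr0n.
  have cQ : {for c, continuous Q} by apply: C1_at_continuous; exact: CQ.
  by apply: (cQ [set s | 1 < s]); apply: open_nbhs_nbhs; split; [exact: open_gt|].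
have cix : {for x, continuous (chart i)} by exact: chart_continuous.
have : \forall z \near x, 1 < Q (chart i z) by exact: (cix _ Q1).
apply: filterS2 (near_chart_dom ix) => z iz /ltW Qz.
by rewrite /w patchE mem_set//= smoothstep_ge1.
Qed.

(** Each summand is the difference of two consecutive partial products. *)
Lemma telescope_onem_prod (A : comPzRingType) (W : nat -> A) N :
  \sum_(k < N) W k * \prod_(j < k) (1 - W j) = 1 - \prod_(j < N) (1 - W j).
Proof.
elim: N => [|N IH]; first by rewrite !big_ord0 subrr.
by rewrite !big_ord_recr /= IH; ring.
Qed.

(** Bumps [w_k] are combined as [w_k] times the product of the earlier [1 - w_j]. The sum telescopes
    to [1] wherever some [w_j] is [1], and no division by a sum of bumps is needed. *)
Lemma partition_of_unity (K : set M) : compact K ->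
  exists (N : nat) (I : nat -> chart_index M) (L : nat -> set M) (chi : nat -> M -> R),
  [/\ forall k, compact (L k), forall k, L k `<=` chart_dom (I k),
    forall k x, ~ L k x -> chi k x = 0, forall k, C1_manifold (chi k) &
    (forall k x, 0 <= chi k x) /\ forall x, K x -> \sum_(k < N) chi k x = 1].
Proof.
move=> cK.
have [I bI] := choice bump_function; have [L bL] := choice bI.
have [w bw] := choice bL.
pose U x := [set z | w x z = 1]°.
have : cover_compact K by rewrite -compact_cover.
move=> /(_ M setT U (fun x _ => open_interior _)) [].
  move=> x Kx; exists x => //; rewrite /U /interior.
  by have [_ _ _ _ []] := bw x.
(* Beyond the end of [s] the default [point] is still a point of the manifold, so the clauses
   quantified over all [k] hold there too. *)
move=> D _ DK; pose s := finmap.enum_fset D; pose p k := nth point s k.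
exists (size s), (I \o p), (L \o p),
  (fun k z => w (p k) z * \prod_(j < k) (1 - w (p j) z)).
have wP x : [/\ compact (L x), L x `<=` chart_dom (I x),
  forall z, ~ L x z -> w x z = 0, C1_manifold (w x) & forall z, 0 <= w x z <= 1].
  by have [? ? ? ? []] := bw x.
split=> [k|k|k x Lx|k|].
- by have [] := wP (p k).
- by have [] := wP (p k).
- by have [_ _ w0 _ _] := wP (p k); rewrite w0// mul0r.
- have Cw x : C1_manifold (w x) by have [] := wP x.
  apply: C1_manifoldM => //.
  apply: (@C1_manifold_prod k (fun j x => 1 - w (p j) x)) => j.
  exact: C1_manifold_onem.
have w01 x z : 0 <= w x z <= 1 by have [] := wP x.
split=> [k x|x Kx].
  rewrite mulr_ge0 ?prodr_ge0//; first by have /andP[] := w01 (p k) x.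
  by move=> j _; rewrite subr_ge0; have /andP[] := w01 (p j) x.
rewrite (telescope_onem_prod (fun k => w (p k) x)).
have [y yD /interior_subset /= wx1] := DK x Kx.
have ks : (index y s < size s)%N by rewrite index_mem.
rewrite (bigD1 (Ordinal ks))//= /p nth_index// wx1 subrr mul0r subr0//.
Qed.

End C1_manifold.

(** * The divergence theorem *)

Section change_of_chart.
Context {R : realType} {n : nat} {M : smooth_manifold R n}.
Implicit Types (i j : chart_index M) (u : M -> R) (X : vector_field M).

Lemma transition_differentiable i j x : chart_dom i x -> chart_dom j x ->
  differentiable (transition i j) (chart i x).
Proof.
move=> ix jx; apply: (nbhs_singleton (near_differentiable_rV _)) => l.
exact: C1_at_transition.
Qed.

Lemma partial_change_of_chart i j x u k : chart_dom i x -> chart_dom j x ->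
  C1_manifold u ->
  partial k (u \o chart_inv i) (chart i x) =
  \sum_l jacobian (transition i j) (chart i x) k l
    * partial l (u \o chart_inv j) (chart j x).
Proof.
move=> ix jx Cu; have dt := transition_differentiable ix jx.
have tx : transition i j (chart i x) = chart j x by rewrite /transition /= chartK.
rewrite -(nbhs_singleton (near_eq_partial k (near_transition u ix jx))).
rewrite partial_comp_rV; last 2 first.
- exact: dt.
- by rewrite tx; apply: C1_at_diff; apply: Cu; exists x.
by apply: eq_bigr => l _; rewrite jacobian_partial// tx.
Qed.

Definition vector_field_change X := forall i j x,
  chart_dom i x -> chart_dom j x ->
  X i (chart i x) *m jacobian (transition i j) (chart i x) = X j (chart j x).

Lemma chart_lie_derivative_change X u i j x : vector_field_change X ->
  C1_manifold u -> chart_dom i x -> chart_dom j x ->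
  chart_lie_derivative X u i x = chart_lie_derivative X u j x.
Proof.
move=> Xc Cu ix jx; rewrite /chart_lie_derivative.
under eq_bigr do rewrite (partial_change_of_chart _ ix jx Cu) mulr_sumr.
rewrite exchange_big; apply: eq_bigr => l _ /=.
by rewrite -(Xc _ _ _ ix jx) mxE mulr_suml; apply: eq_bigr => k _; rewrite mulrA.
Qed.

(** The differential changes by [J^T] and the inverse metric by the inverted form of
    [metric_change]; together they make the gradient contravariant. *)
Lemma endo_grad_change (g : riemannian_metric M) (P : bundle_endomorphism M) u :
  C1_manifold u -> vector_field_change (endo_apply P (grad g u)).
Proof.
move=> Cu i j x ix jx; rewrite /endo_apply /grad.
set J := jacobian (transition i j) (chart i x).
set di := \row_k _; set dj := (\row_k partial k _ _ in RHS).
have ici : chart_cod i (chart i x) by exists x.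
have jcj : chart_cod j (chart j x) by exists x.
have dij : di = dj *m J^T.
  apply/rowP => k; rewrite !mxE (partial_change_of_chart _ ix jx Cu).
  by apply: eq_bigr => l _; rewrite !mxE mulrC.
have gE := metric_change g ix jx; rewrite /= -/J in gE.
have Gj := metric_unitmx g jcj.
(* [J] is invertible because [det J] divides the nonzero determinant of [g] in chart [i]. *)
have Ju : J \in unitmx.
  have := metric_det_neq0 g ici.
  by rewrite gE !det_mulmx !mulf_eq0 !negb_or unitmxE unitfE => /andP[/andP[]].
have key : J^T *m invmx (g i (chart i x)) *m J = invmx (g j (chart j x)).
  have e : g j (chart j x) *m (J^T *m invmx (g i (chart i x)) *m J) = 1%:M.
    rewrite -[LHS](mulKmx Ju) -[RHS](mulVmx Ju); congr (_ *m _).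
    by rewrite !mulmxA -gE mulmxV ?mul1mx// metric_unitmx.
  by rewrite -[LHS](mulKmx Gj) e mulmx1.
have Pc := endo_change P ix jx; rewrite /= -/J in Pc.
by rewrite -[LHS]mulmxA Pc dij -key !mulmxA.
Qed.

End change_of_chart.

(** The metric in [inner] cancels the inverse metric in [grad]. *)
Lemma inner_fieldE {R : realType} {n : nat} {M : smooth_manifold R n}
    (g : riemannian_metric M) (X : vector_field M) (u : M -> R) i x :
  chart_dom i x ->
  inner_field g X (grad g u) i x = chart_lie_derivative X u i x.
Proof.
move=> ix; have ici : chart_cod i (chart i x) by exists x.
rewrite /inner_field /inner /grad trmx_mul invmx_metric_sym// mulmxA.
rewrite mulmxK ?metric_unitmx// mxE.
by apply: eq_bigr => k _; rewrite !mxE.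
Qed.

Section compact_integrable.
Context {R : realType} {n : nat} {M : smooth_manifold R n}.
Variables (g : riemannian_metric M) (vol : {measure set (borel M) -> \bar R}).
Hypothesis vol_g : is_riemannian_volume g vol.

Lemma integrable_compact_support (K : set M) (h : M -> R) :
  compact K -> continuous h -> (forall x, ~ K x -> h x = 0) ->
  vol.-integrable setT (EFin \o h).
Proof.
move=> cK ch h0.
have [N [I [L [chi [cL LI chi0 Cchi [_ chi1]]]]]] := partition_of_unity cK.
rewrite (_ : _ \o _ = (fun x => \sum_(k < N) (chi k x * h x)%:E)); last first.
  apply/funext => x /=; rewrite sumEFin -mulr_suml.
  have [Kx|Kx] := pselect (K x); first by rewrite chi1// mul1r.
  by rewrite h0// mulr0.
apply: integrable_sum => // k _.
apply: (integrable_vol_chart vol_g (cL k) (LI k) (w := fun x => chi k x * h x)).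
  by move=> x Lx; rewrite chi0// mul0r.
move=> y iy; apply: (@continuousMR _ _ (chi k \o chart_inv (I k)) (h \o chart_inv (I k))).
  by apply: C1_at_continuous; exact: Cchi.
by apply: continuous_comp; [exact: chart_inv_cod_continuous|exact: ch].
Qed.

End compact_integrable.

(** * The integrated divergence inequality for [phi(f) X] *)

Section divergence_inequality.
Context {R : realType} {n : nat} {M : smooth_manifold R n}.
Variables (g : riemannian_metric M) (vol : {measure set (borel M) -> \bar R}).
Hypothesis vol_g : is_riemannian_volume g vol.
Variables (X : vector_field M) (f : M -> R) (phi dphi : R -> R) (c : R) (H : M -> R).
Hypothesis CX : forall i k y, chart_cod i y -> C1_at (fun z => X i z 0 k) y.
Hypothesis Xc : vector_field_change X.
Hypothesis Cf : C1_manifold f.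
Hypothesis f_compact : compact [set x | f x <= c].
Hypothesis phiE : forall s, is_derive s (1 : R) phi (dphi s).
Hypothesis dphi_continuous : continuous dphi.
Hypothesis phi0 : forall s, c <= s -> phi s = 0.
Hypothesis dphi0 : forall s, c <= s -> dphi s = 0.
Hypothesis H_continuous : continuous H.
Hypothesis H0 : forall x, c <= f x -> H x = 0.
Hypothesis divH : forall i x, chart_dom i x ->
  phi (f x) * divergence g X i x + dphi (f x) * chart_lie_derivative X f i x <= H x.

Let theta := phi \o f.

Let Ctheta : C1_manifold theta.
Proof. by move=> i y iy; exact: C1_at_comp_derive phiE dphi_continuous (Cf iy). Qed.

Let lieM u v i x : chart_dom i x -> C1_manifold u -> C1_manifold v ->
  chart_lie_derivative X (u \* v) i x =
  u x * chart_lie_derivative X v i x + v x * chart_lie_derivative X u i x.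
Proof.
move=> ix Cu Cv; have iy : chart_cod i (chart i x) by exists x.
rewrite /chart_lie_derivative !mulr_sumr -big_split; apply: eq_bigr => k _ /=.
rewrite (@partialM _ _ (u \o chart_inv i) (v \o chart_inv i)).
- by rewrite /= chartK//; ring.
- exact: Cu.
- exact: Cv.
Qed.

Let lie_theta i x : chart_dom i x ->
  chart_lie_derivative X theta i x = dphi (f x) * chart_lie_derivative X f i x.
Proof.
move=> ix; have iy : chart_cod i (chart i x) by exists x.
rewrite /chart_lie_derivative mulr_sumr; apply: eq_bigr => k _.
rewrite (@partial_comp _ _ phi (f \o chart_inv i)).
- by rewrite derive1E /= chartK//; have [_ ->] := phiE (f x); ring.
- by have [] := phiE ((f \o chart_inv i) (chart i x)).
- by apply: C1_at_diff; exact: Cf.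
Qed.

(* Integrating the pieces [chi_k phi(f) X] of a partition of unity chart by
   chart, the terms in [X chi_k] cancel because the [chi_k] sum to [1]. *)
Lemma integral_divergence_ge0 : (0 <= \int[vol]_x (H x)%:E)%E.
Proof.
have [N [I [L [chi [cL LI chi0 Cchi [chi_ge0 chi1]]]]]] := partition_of_unity f_compact.
pose W k := chart_div_scaled g (I k) X (chi k \* theta).
have u0 k x : ~ L k x -> (chi k \* theta) x = 0 by move=> Lx; rewrite /= chi0// mul0r.
have Cu k : C1_manifold (chi k \* theta) by exact: (C1_manifoldM (Cchi k) Ctheta).
have iW k : vol.-integrable setT (EFin \o W k).
  exact: (integrable_div_scaled vol_g (@CX (I k)) (cL k) (LI k) (u0 k) (Cu k (I k))).
have W0 k : (\int[vol]_x (W k x)%:E = 0)%E.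
  exact: (integral_div_scaled_eq0 vol_g (@CX (I k)) (cL k) (LI k) (u0 k) (Cu k (I k))).
(* The inequality is strict because the sum of the [chi_k] must be [1] on a whole neighbourhood of
   [x] to be differentiated. *)
have sum_lie j x : chart_dom j x -> f x < c ->
    \sum_(k < N) chart_lie_derivative X (chi k) j x = 0.
  move=> jx fc; rewrite exchange_big big1// => l _ /=.
  rewrite -mulr_sumr.
  have jy : chart_cod j (chart j x) by exists x.
  rewrite -partial_sum; last by move=> k; exact: Cchi.
  rewrite -(nbhs_singleton (near_eq_partial l (F := cst 1) _)).
    by rewrite /partial derive_cst mulr0.
  have near_fc : nbhs (chart_inv j (chart j x)) [set z | f z < c].
    have cf : {for x, continuous f} by apply: C1_manifold_continuous.
    rewrite chartK//; apply: (cf [set s | s < c]).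
    by apply: open_nbhs_nbhs; split; [exact: open_lt|].
  have cjx : {for chart j x, continuous (chart_inv j)} by exact: chart_inv_continuous.
  have : \forall z \near chart j x, f (chart_inv j z) < c by exact: (cjx _ near_fc).
  by apply: filterS => z /ltW fz; rewrite [RHS](chi1 _ fz).
have WE k x : chart_dom (I k) x -> W k x =
    chi k x * (theta x * divergence g X (I k) x
      + dphi (f x) * chart_lie_derivative X f (I k) x)
    + theta x * chart_lie_derivative X (chi k) (I k) x.
  move=> kx; rewrite /W /chart_div_scaled patchE mem_set//.
  by rewrite (lieM kx (Cchi k) Ctheta) (lie_theta kx) /=; ring.
have Wout k x : ~ chart_dom (I k) x -> W k x = 0.
  by move=> kx; rewrite /W /chart_div_scaled patchE memNset.
have Wle x : \sum_(k < N) W k x <= H x.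
  have [fc|fc] := ltP (f x) c; last first.
    rewrite H0// big1// => k _; have [kx|/Wout//] := pselect (chart_dom (I k) x).
    by rewrite WE// /theta /= phi0// dphi0// !mul0r !addr0 mulr0.
  have [j jx] := chart_dom_cover x.
  (* The added sum is zero by [sum_lie]. It allows a comparison term by term, each [k] using the
     hypothesis in its own chart, while the derivatives of the [chi_k] are moved to the common chart
     [j]. *)
  rewrite (_ : H x = \sum_(k < N) chi k x * H x
      + \sum_(k < N) theta x * chart_lie_derivative X (chi k) j x); last first.
    rewrite -mulr_suml -mulr_sumr.
    have -> : \sum_(k < N) chi k x = 1 by apply: chi1; exact: ltW.
    by rewrite (sum_lie j x jx fc) mulr0 addr0 mul1r.
  rewrite -big_split/=; apply: ler_sum => k _.
  have [kx|kx] := pselect (chart_dom (I k) x).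
    rewrite WE// (chart_lie_derivative_change Xc (Cchi k) kx jx) lerD2r.
    by rewrite ler_wpM2l//; exact: divH.
  have Lx : ~ L k x by move=> /LI.
  rewrite Wout// chi0// (chart_lie_derivative0 X (cL k) (@chi0 k) jx Lx).
  by rewrite mul0r mulr0 addr0.
have iH : vol.-integrable setT (EFin \o H).
  apply: (integrable_compact_support vol_g f_compact) => // x fx.
  by apply: H0; rewrite leNgt; apply/negP => /ltW.
have iWs : vol.-integrable setT (fun x => \sum_(k < N) (W k x)%:E)%E.
  by apply: integrable_sum => // k _; exact: iW.
rewrite (_ : 0%E = \int[vol]_x (\sum_(k < N) (W k x)%:E))%E; last first.
  rewrite integral_sum//; last by move=> k; exact: iW.
  by apply/esym/big1 => k _; exact: W0.
apply: le_integral => // x _.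
by rewrite sumEFin lee_fin.
Qed.

End divergence_inequality.

(** * Weighted volumes *)

Section cutoff.
Context {R : realType}.
Implicit Types m s t : R.

Definition cutoff m s := smoothstep (m + 1 - s).

Lemma cutoff_ge0 m s : 0 <= cutoff m s. Proof. exact: smoothstep_ge0. Qed.

Lemma cutoff_le1 m s : cutoff m s <= 1. Proof. exact: smoothstep_le1. Qed.

Lemma cutoff1 m s : s <= m -> cutoff m s = 1.
Proof. by move=> sm; apply: smoothstep_ge1; rewrite -addrA addrCA lerDl subr_ge0. Qed.

Lemma cutoff0 m s : m + 1 <= s -> cutoff m s = 0.
Proof. by move=> sm; apply: smoothstep_le0; rewrite subr_le0. Qed.

Lemma le_cutoff m m' s : m <= m' -> cutoff m s <= cutoff m' s.
Proof. by move=> mm; apply: le_smoothstep; rewrite lerD2r lerD2r. Qed.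

Lemma is_derive_cutoff m s :
  is_derive s (1 : R) (cutoff m) (- smoothstep' (m + 1 - s)).
Proof.
have dsub : is_derive s (1 : R) (fun t => m + 1 - t) (-1).
  have := is_deriveB (is_derive_cst (m + 1 : R) s 1) (is_derive_id s (1 : R)).
  by rewrite sub0r.
have [dd dE] := dsub; have [ds sE] := is_derive_smoothstep (m + 1 - s).
have dc : derivable (smoothstep \o (fun t => m + 1 - t)) s 1.
  apply/derivable1_diffP; apply: differentiable_comp; apply/derivable1_diffP.
    exact: dd.
  exact: ds.
apply: (@DeriveDef _ _ _ _ _ _ _ dc).
by rewrite -derive1E derive1_comp; [rewrite !derive1E sE dE mulrN1|exact: dd|exact: ds].
Qed.

Lemma continuous_cutoff' m : continuous (fun s => - smoothstep' (m + 1 - s)).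
Proof.
move=> s; apply: (@continuous_comp _ _ _ (fun t => smoothstep' (m + 1 - t)) -%R).
  apply: (@continuous_comp _ _ _ (fun t => m + 1 - t) smoothstep').
    apply: (@continuousDR _ _ (cst (m + 1)) -%R); first exact: cst_continuous.
    exact: oppr_continuous.
  exact: continuous_smoothstep'.
exact: oppr_continuous.
Qed.

Lemma continuous_cutoff m : continuous (cutoff m).
Proof.
move=> s; apply: differentiable_continuous; apply/derivable1_diffP.
by have [] := is_derive_cutoff m s.
Qed.

Lemma is_derive_expR_scale c s :
  is_derive s (1 : R) (fun t => expR (c * t)) (c * expR (c * s)).
Proof.
have dscale : is_derive s (1 : R) (fun t => c * t) c.
  have := is_deriveZ c (is_derive_id s (1 : R)).
  by rewrite [c *: 1]mulr1.
have [dd dE] := dscale; have [ds sE] := is_derive_expR (c * s).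
have dc : derivable (expR \o (fun t => c * t)) s 1.
  apply/derivable1_diffP; apply: differentiable_comp; apply/derivable1_diffP.
    exact: dd.
  exact: ds.
apply: (@DeriveDef _ _ _ _ _ _ _ dc).
by rewrite -derive1E derive1_comp; [rewrite !derive1E sE dE mulrC|exact: dd|exact: ds].
Qed.

Lemma continuous_expR_scale c : continuous (fun t : R => expR (c * t)).
Proof.
move=> s; apply: differentiable_continuous; apply/derivable1_diffP.
by have [] := is_derive_expR_scale c s.
Qed.

End cutoff.

(** * The weighted inequality and its consequences *)

Section weighted_volume.
Context {R : realType} {n : nat} {M : smooth_manifold R n}.
Variables (g : riemannian_metric M) (vol : {measure set (borel M) -> \bar R}).
Hypothesis vol_g : is_riemannian_volume g vol.
Variables (P : bundle_endomorphism M) (f : M -> R) (alpha beta a : R).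
Hypothesis f_C2 : Ck_manifold 2 f.
Hypothesis f_proper : proper_map f.
Hypothesis f_ge0 : forall x, 0 <= f x.
Hypotheses (alpha_gt0 : 0 < alpha) (beta_gt0 : 0 < beta) (a_ge0 : 0 <= a).

Let X := endo_apply P (grad g f).

Hypothesis h1 : forall i x, chart_dom i x ->
  divergence g X i x - alpha * inner_field g X (grad g f) i x + beta * f x <= a.
Hypothesis h2 : forall i x, chart_dom i x -> divergence g X i x <= a.
Hypothesis h3 : forall i x, chart_dom i x -> 0 <= inner_field g X (grad g f) i x.

Let C1_partial i k y : chart_cod i y -> C1_at (partial k (f \o chart_inv i)) y.
Proof. by move=> iy; apply: chart_cod_C1_at iy; have [_] := f_C2 i; exact. Qed.

Let Cf : C1_manifold f.
Proof.
move=> i y iy; split=> [|k].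
  have [df _] := f_C2 i.
  by apply: filterS (near_chart_cod iy) => z; exact: df.
by apply: C1_at_continuous; exact: C1_partial.
Qed.

Let CX i k y : chart_cod i y -> C1_at (fun z => X i z 0 k) y.
Proof.
move=> iy; rewrite (_ : (fun _ => _) = (fun z => \sum_b
    (\sum_c partial c (f \o chart_inv i) z * invmx (g i z) c b) * P i z b k)).
  apply: C1_at_sum => b _; apply: C1_atM.
    apply: C1_at_sum => c _; apply: C1_atM; first exact: C1_partial.
    exact: C1_at_invmx_metric.
  exact: (chart_cod_C1_at (endo_smooth P i b k 1)).
apply/funext => z; rewrite /X /endo_apply /grad mxE; apply: eq_bigr => b _.
by rewrite mxE; congr (_ * _); apply: eq_bigr => c _; rewrite mxE.
Qed.

Let cf : continuous f. Proof. exact: C1_manifold_continuous. Qed.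

(** Nonnegativity of [f] makes the sublevel set the preimage of a compact interval, to which
    properness applies. *)
Let f_compact c : compact [set x | f x <= c].
Proof.
rewrite (_ : [set x | _] = f @^-1` `[0, c]); first exact/f_proper/segment_compact.
by apply/seteqP; split=> x /=; rewrite in_itv/= f_ge0.
Qed.

Let integrable_cutoff m (h : R -> R) : continuous h ->
  vol.-integrable setT (fun x => (cutoff m (f x) * h (f x))%:E).
Proof.
move=> ch.
suff : vol.-integrable setT (EFin \o (fun x => cutoff m (f x) * h (f x))) by [].
apply: (integrable_compact_support vol_g (@f_compact (m + 1))).
  move=> x; apply: (@continuousMR _ _ (cutoff m \o f) (h \o f)).
    by apply: continuous_comp; [exact: cf|exact: continuous_cutoff].
  by apply: continuous_comp; [exact: cf|exact: ch].
by move=> x /negP; rewrite -ltNge => /ltW /cutoff0 ->; rewrite mul0r.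
Qed.

Let weight lambda s := expR (- lambda * s) * (a - lambda / alpha * beta * s).

Let continuous_weight lambda : continuous (weight lambda).
Proof.
move=> s; apply: (@continuousMR _ _ (fun s => expR (- lambda * s))
  (fun s => a - lambda / alpha * beta * s)); first exact: continuous_expR_scale.
apply: (@continuousDR _ _ (cst a)); first exact: cst_continuous.
apply: continuousN; apply: continuousMR; first exact: cst_continuous.
by move=> ?.
Qed.

(* With [lambda <= alpha], the bound on [div X - lambda <X, grad f>] is a convex
   combination of the first two hypotheses. *)
Lemma integral_weight_ge0 m lambda : 0 < lambda -> lambda <= alpha ->
  (0 <= \int[vol]_x (cutoff m (f x) * weight lambda (f x))%:E)%E.
Proof.
move=> l0 la.
pose phi s := cutoff m s * expR (- lambda * s).
pose dphi s := cutoff m s * (- lambda * expR (- lambda * s))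
  + expR (- lambda * s) * - smoothstep' (m + 1 - s).
have phiE s : is_derive s (1 : R) phi (dphi s).
  exact: (is_deriveM (is_derive_cutoff m s) (is_derive_expR_scale (- lambda) s)).
have cdphi : continuous dphi.
  move=> s; apply: (@continuousDR _ _
    (fun s => cutoff m s * (- lambda * expR (- lambda * s)))
    (fun s => expR (- lambda * s) * - smoothstep' (m + 1 - s))); apply: continuousMR.
  - exact: continuous_cutoff.
  - apply: continuousMR; first exact: cst_continuous.
    exact: continuous_expR_scale.
  - exact: continuous_expR_scale.
  - exact: continuous_cutoff'.
have smoothstep'0 s : m + 1 <= s -> smoothstep' (m + 1 - s) = 0.
  by move=> ms; rewrite /smoothstep' [X in _ * (_ * X)]max_l ?mulr0// subr_le0.
apply: (@integral_divergence_ge0 _ _ _ g vol vol_g X f phi dphi (m + 1)) => //.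
- by apply: endo_grad_change.
- by move=> s ms; rewrite /phi cutoff0// mul0r.
- by move=> s ms; rewrite /dphi cutoff0// mul0r smoothstep'0// oppr0 mulr0 addr0.
- move=> x; apply: (@continuousMR _ _ (cutoff m \o f) (weight lambda \o f)).
    by apply: continuous_comp; [exact: cf|exact: continuous_cutoff].
  by apply: continuous_comp; [exact: cf|exact: continuous_weight].
- by move=> x fx; rewrite cutoff0// mul0r.
move=> i x ix; rewrite -(inner_fieldE g X f ix).
have := h1 ix; have := h2 ix; have := h3 ix.
set q := inner_field _ _ _ _ _; set D := divergence _ _ _ _ => q0 Da Dq.
have bound : D - lambda * q <= a - lambda / alpha * beta * f x.
  have la1 : 0 <= lambda / alpha <= 1.
    by apply/andP; split; [rewrite divr_ge0 ?ltW|rewrite ler_pdivrMr ?mul1r].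
  have E : lambda = lambda / alpha * alpha by rewrite divfK// gt_eqF.
  rewrite {1}E; move: la1; set r := lambda / alpha => /andP[r0 r1].
  by nra.
rewrite /phi /dphi /weight.
have e0 : 0 <= expR (- lambda * f x) by exact: expR_ge0.
have := smoothstep'_ge0 (m + 1 - f x); have := cutoff_ge0 m (f x).
set e := expR _ in e0 *; set c := cutoff _ _; set s := smoothstep' _ => c0 s0.
have -> : c * e * D + (c * (- lambda * e) + e * - s) * q
    = c * (e * (D - lambda * q)) - e * s * q by ring.
apply: (@le_trans _ _ (c * (e * (D - lambda * q)))).
  by rewrite gerBl; apply: mulr_ge0 => //; apply: mulr_ge0.
by rewrite ler_wpM2l// ler_wpM2l.
Qed.

Let expf_ge0 lambda x : 0 <= expR (- lambda * f x). Proof. exact: expR_ge0. Qed.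

(** The truncated integrals are bounded by a quantity independent of the level [k]; monotone
    convergence in [k] removes the cutoff. *)
Lemma integral_expR_lty : (\int[vol]_x (expR (- alpha * f x))%:E < +oo)%E.
Proof.
(* The threshold beyond which [1 + a - beta f <= 0]. *)
pose t := (a + 1) / beta.
have icut : vol.-integrable setT (fun x => (cutoff t (f x) * (1 + a))%:E).
  by apply: (@integrable_cutoff t (cst (1 + a))); exact: cst_continuous.
pose u (k : nat) x := (cutoff k%:R (f x) * expR (- alpha * f x))%:E.
have iu k : vol.-integrable setT (u k).
  by apply: (@integrable_cutoff _ (fun s => expR (- alpha * s)));
    exact: continuous_expR_scale.
have u_le k : (\int[vol]_x u k x <= \int[vol]_x (cutoff t (f x) * (1 + a))%:E)%E.
  have iw := @integrable_cutoff k%:R _ (@continuous_weight alpha).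
  (* Adding the nonnegative integral of [weight alpha] turns the integrand into
     [psi e^(-alpha f) (1 + a - beta f)], which can be positive only where [f < t] and is at most
     [1 + a] there. *)
  rewrite -[leLHS]adde0.
  apply: (le_trans (leeD2l _ (integral_weight_ge0 k%:R alpha_gt0 (lexx _)))).
  rewrite -integralD//; apply: le_integral => //.
    exact: integrableD.
  move=> x _; rewrite /u -EFinD lee_fin /weight divff ?gt_eqF// mul1r.
  have c0 := cutoff_ge0 k%:R (f x); have c1 := cutoff_le1 k%:R (f x).
  have e0 := expf_ge0 alpha x.
  have e1 : expR (- alpha * f x) <= 1.
    by rewrite -expR0 ler_expR mulNr oppr_le0 mulr_ge0// ltW.
  have bf0 : 0 <= beta * f x by rewrite mulr_ge0// ltW.
  have ce0 : 0 <= cutoff k%:R (f x) * expR (- alpha * f x) by exact: mulr_ge0.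
  have ce1 : cutoff k%:R (f x) * expR (- alpha * f x) <= 1 by exact: mulr_ile1.
  rewrite mulrA -{1}[_ * expR _]mulr1 -mulrDr addrA.
  have [tf|ft] := leP t (f x).
    have : a + 1 <= beta * f x by rewrite mulrC -ler_pdivrMr.
    move=> bf; apply: (@le_trans _ _ 0); last by rewrite mulr_ge0 ?cutoff_ge0// addr_ge0.
    by apply: mulr_ge0_le0 => //; rewrite subr_le0 addrC.
  rewrite [cutoff t _]cutoff1 ?mul1r; last exact: ltW.
  apply: (@le_trans _ _ (cutoff k%:R (f x) * expR (- alpha * f x) * (1 + a))).
    by rewrite ler_wpM2l// gerBl.
  by rewrite ler_piMl// addr_ge0.
have ulim x : (expR (- alpha * f x))%:E = limn (u ^~ x).
  apply/esym/cvg_lim => //; apply: cvg_near_cst.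
  near=> k; rewrite /u cutoff1 ?mul1r//.
  by near: k; exact: nbhs_infty_ger.
under eq_integral do rewrite ulim.
have mono : {homo (fun k => \int[vol]_x u k x)%E : k l / (k <= l)%N >-> (k <= l)%E}.
  move=> k l kl; apply: le_integral => // x _.
  by rewrite lee_fin ler_wpM2r// le_cutoff// ler_nat.
rewrite monotone_convergence//.
- apply: (le_lt_trans (lime_le _ _)); first exact: ereal_nondecreasing_is_cvgn.
    by apply: nearW => k; exact: u_le.
  exact: integral_fune_lt_pinfty.
- by move=> k; exact: measurable_int (iu k).
- by move=> k x _; rewrite lee_fin mulr_ge0// cutoff_ge0.
- by move=> x _ k l kl; rewrite lee_fin ler_wpM2r// le_cutoff// ler_nat.
Unshelve. all: end_near. Qed.

(** * Monotonicity in [lambda = expR s] *)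

Section monotone.
Variable m : R.
Let mu := alpha * a / beta.
(* For [lambda = expR s] this is [psi(f) lambda^mu e^(-lambda f)]. *)
Let k s x := cutoff m (f x) * expR (mu * s - expR s * f x).
Let dk s x := cutoff m (f x) * ((mu - expR s * f x) * expR (mu * s - expR s * f x)).

Let mu_ge0 : 0 <= mu.
Proof. by rewrite divr_ge0 ?mulr_ge0// ltW. Qed.

Let is_derive_k s x : is_derive s (1 : R) (k ^~ x) (dk s x).
Proof.
have d1 : is_derive s (1 : R) (fun t => mu * t - expR t * f x) (mu - expR s * f x).
  have := is_deriveB (is_deriveZ mu (is_derive_id s (1 : R)))
    (is_deriveZ (f x) (is_derive_expR s)).
  rewrite [mu *: 1]mulr1 [f x *: _]mulrC.
  by congr is_derive; apply/funext => t; rewrite (mulrC (expR t)).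
have [dd dE] := d1; have [ds sE] := is_derive_expR (mu * s - expR s * f x).
have dc : derivable (expR \o (fun t => mu * t - expR t * f x)) s 1.
  apply/derivable1_diffP; apply: differentiable_comp; apply/derivable1_diffP.
    exact: dd.
  exact: ds.
have d2 : is_derive s (1 : R) (expR \o (fun t => mu * t - expR t * f x))
    ((mu - expR s * f x) * expR (mu * s - expR s * f x)).
  apply: (@DeriveDef _ _ _ _ _ _ _ dc).
  by rewrite -derive1E derive1_comp; [rewrite !derive1E sE dE mulrC|exact: dd|exact: ds].
exact: (is_deriveZ (cutoff m (f x)) d2).
Qed.

Lemma integrable_cutoff_expR s : vol.-integrable setT (EFin \o k s).
Proof.
apply: (@integrable_cutoff m (fun y => expR (mu * s - expR s * y))) => y.
apply: (@continuous_comp _ _ _ (fun y => mu * s - expR s * y) expR).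
  apply: (@continuousDR _ _ (cst (mu * s))); first exact: cst_continuous.
  apply: continuousN; apply: continuousMR; first exact: cst_continuous.
  by move=> ?.
exact: continuous_expR.
Qed.

(* [lambda d/dlambda] of the weight is a positive multiple of the integrand of
   [integral_weight_ge0]. *)
Let dkE s x : dk s x = alpha / beta * expR (mu * s)
  * (cutoff m (f x) * weight (expR s) (f x)).
Proof.
rewrite /dk /weight expRD mulNr /mu.
by field; rewrite !gt_eqF.
Qed.

Let dk_ge0 s : s <= ln alpha -> 0 <= \int[vol]_x dk s x.
Proof.
move=> sl; rewrite /Rintegral; apply: fine_ge0.
under eq_integral do rewrite dkE EFinM.
rewrite integralZl//; last first.
  by apply: (@integrable_cutoff m (weight (expR s))); exact: continuous_weight.
apply: mule_ge0; first by rewrite lee_fin mulr_ge0 ?expR_ge0// divr_ge0 ?ltW.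
apply: integral_weight_ge0; first exact: expR_gt0.
by rewrite -(lnK alpha_gt0) ler_expR.
Qed.

(** Differentiation under the integral sign: the cutoff bounds [f] by [m + 1] on its support, so the
    derivative in [s] is dominated, and its integral is nonnegative for [s <= ln alpha]. *)
Lemma le_integral_expR s : s <= ln alpha ->
  (\int[vol]_x (k s x)%:E <= \int[vol]_x (k (ln alpha) x)%:E)%E.
Proof.
move=> sl; pose F s := \int[vol]_x k s x.
have FE t : (F t)%:E = (\int[vol]_x (k t x)%:E)%E.
  by rewrite /F /Rintegral fineK//; exact: integrable_fin_num (integrable_cutoff_expR t).
rewrite -!FE lee_fin.
(* An open interval around the closed one, so that [F] is differentiable, hence continuous, at the
   endpoints too. *)
pose u := s - 1; pose v := ln alpha + 1.
(* Bounds the two factors of [dk] for [t < v] and [0 <= f <= m + 1]; the absolute value covers a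
   negative [m + 1]. *)
pose C := (mu + expR v * `|m + 1|) * expR (mu * v).
have dbound t x : t \in `]u, v[ -> `|dk t x| <= cutoff m (f x) * C.
  rewrite in_itv/= => /andP[_ /ltW tv].
  rewrite /dk normrM (ger0_norm (cutoff_ge0 _ _)).
  have [fm|fm] := leP (f x) (m + 1); last first.
    have -> : cutoff m (f x) = 0 by apply: cutoff0; exact: ltW.
    by rewrite !mul0r.
  rewrite ler_wpM2l ?cutoff_ge0// normrM (ger0_norm (expR_ge0 _)) ler_pM//.
    rewrite (le_trans (ler_normB _ _))// (ger0_norm mu_ge0) lerD2l.
    rewrite ger0_norm ?mulr_ge0 ?expR_ge0// ler_pM ?expR_ge0 ?ler_expR//.
    exact: le_trans fm (ler_norm _).
  rewrite ler_expR (@le_trans _ _ (mu * t))//.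
    by rewrite gerBl mulr_ge0 ?expR_ge0.
  exact: ler_wpM2l.
have p1E t x : partial1of2 k t x = dk t x.
  by rewrite partial1of2E; have [_] := is_derive_k t x.
have iG : vol.-integrable setT (EFin \o (fun x => cutoff m (f x) * C)).
  by apply: (@integrable_cutoff m (cst C)); exact: cst_continuous.
have G0 x : 0 <= cutoff m (f x) * C.
  by rewrite mulr_ge0 ?cutoff_ge0// mulr_ge0 ?expR_ge0// addr_ge0// mulr_ge0 ?expR_ge0.
have dF t : t \in `]u, v[ -> derivable F t 1 /\ F^`()%classic t = \int[vol]_x dk t x.
  move=> tuv; have Gub t' x : `]u, v[%classic t' -> setT x ->
      `|partial1of2 k t' x| <= cutoff m (f x) * C.
    by move=> /= ht _; rewrite p1E; exact: dbound.
  have dk1 t' x : `]u, v[%classic t' -> setT x -> derivable (k ^~ x) t' 1.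
    by move=> _ _; have [] := is_derive_k t' x.
  split.
    exact: (@derivable_under_integral _ _ _ vol k setT measurableT t u v tuv
      (fun t' _ => integrable_cutoff_expR t') dk1 _ G0 iG Gub).
  rewrite (@differentiation_under_integral _ _ _ vol k setT measurableT t u v tuv
      (fun t' _ => integrable_cutoff_expR t') dk1 _ G0 iG Gub).
  by apply: eq_Rintegral => x _; rewrite p1E.
have suv t : s <= t <= ln alpha -> t \in `]u, v[.
  by rewrite in_itv/= /u /v => /andP[st tl]; apply/andP; split; lra.
have oo_cc t : t \in `]s, ln alpha[ -> s <= t <= ln alpha.
  by rewrite in_itv/= => /andP[/ltW -> /ltW ->].
apply: (@ger0_derive1_le_cc _ F s (ln alpha)) => //.
- by move=> t /oo_cc/suv/dF[].
- by move=> t tI; have /suv/dF[_ ->] := oo_cc _ tI; apply: dk_ge0;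
    have /andP[] := oo_cc _ tI.
- apply: derivable_within_continuous => t; rewrite in_itv/= => tI.
  by have [] := dF _ (suv _ tI).
- by rewrite in_itv/= lexx.
- by rewrite in_itv/= lexx andbT.
Qed.

End monotone.

Lemma volume_sublevel r : 1 <= r ->
  (vol [set x | (2 * Num.sqrt (f x) <= Num.sqrt (2 * beta) * r)%R]
     <= (expR (alpha * beta / 2))%:E
        * (\int[vol]_x (expR (- alpha * f x))%:E)
        * (r `^ (2 * alpha * a / beta))%:E)%E.
Proof.
move=> r1; have r0 : 0 < r by exact: lt_le_trans r1.
set D := [set x | _].
have mD : measurable (D : set (borel M)).
  have cs : continuous (fun x => 2 * Num.sqrt (f x)).
    move=> x; apply: (@continuousMR _ _ (cst 2) (fun x => Num.sqrt (f x))).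
      exact: cst_continuous.
    apply: (@continuous_comp _ _ _ f Num.sqrt); first exact: cf.
    exact: sqrt_continuous.
  have := continuous_borel_measurable cs measurableT
    (measurable_itv `]-oo, Num.sqrt (2 * beta) * r]).
  by rewrite setTI; congr measurable; apply/seteqP; split=> x; rewrite /D /= in_itv.
(* Squaring the inequality that defines [D] gives [4 f <= 2 beta r^2]; the cutoff at this level is
   [1] on [D]. *)
pose m := beta * r ^+ 2 / 2.
have Dm x : D x -> f x <= m.
  move=> Dx; have : (2 * Num.sqrt (f x)) ^+ 2 <= (Num.sqrt (2 * beta) * r) ^+ 2.
    by rewrite ler_sqr// nnegrE mulr_ge0 ?sqrtr_ge0 ?ltW.
  have b0 : 0 <= 2 * beta by rewrite mulr_ge0// ltW.
  rewrite !exprMn !sqr_sqrtr// /m => fx.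
  by rewrite ler_pdivlMr//; lra.
(* [s] is the logarithm of [alpha / r^2]. *)
pose mu := alpha * a / beta; pose s := ln alpha - 2 * ln r.
have sl : s <= ln alpha by rewrite gerBl mulr_ge0// ln_ge0.
have sE : expR s = alpha / r ^+ 2.
  rewrite /s expRB lnK//; congr (_ / _).
  by rewrite mulr_natl mulr2n expRD lnK.
(* The factor [expR (- (mu * s))] cancels [lambda^mu], and the other one compensates
   [e^(-lambda f) >= e^(-alpha beta / 2)] on [D]; so [c] times the integrand dominates the indicator
   of [D]. *)
pose c := expR (alpha * beta / 2) * expR (- (mu * s)).
have c0 : 0 <= c by rewrite mulr_ge0 ?expR_ge0.
have := le_integral_expR m sl; rewrite -/mu => Is.
have -> : vol D = (\int[vol]_x (\1_D x)%:E)%E by rewrite integral_indic// setIT.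
have mk t : measurable_fun [set: borel M]
    (fun x => (cutoff m (f x) * expR (mu * t - expR t * f x))%:E).
  exact: measurable_int (integrable_cutoff_expR m t).
have k0 t x : 0 <= cutoff m (f x) * expR (mu * t - expR t * f x).
  by rewrite mulr_ge0 ?cutoff_ge0 ?expR_ge0.
have mE : measurable_fun [set: borel M] (fun x => (expR (- alpha * f x))%:E).
  apply/measurable_EFinP; apply: continuous_borel_measurable => x.
  apply: (@continuous_comp _ _ _ f (fun s => expR (- alpha * s))); first exact: cf.
  exact: continuous_expR_scale.
apply: (@le_trans _ _ (c%:E * \int[vol]_x
    (cutoff m (f x) * expR (mu * s - expR s * f x))%:E)%E).
  rewrite -ge0_integralZl//; last by move=> x _; rewrite lee_fin.
  apply: ge0_le_integral => //.
  - by apply/measurable_EFinP.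
  - exact: measurable_funeM.
  move=> x _; rewrite -EFinM lee_fin indicE; case: (boolP (x \in D)) => xD; last first.
    by rewrite mulr_ge0.
  have fm := Dm x (set_mem xD); rewrite cutoff1// mul1r /c -!expRD.
  rewrite -[leLHS]expR0 ler_expR sE.
  have : alpha / r ^+ 2 * f x <= alpha / r ^+ 2 * m.
    by rewrite ler_wpM2l// divr_ge0 ?exprn_ge0 ?ltW.
  have -> : alpha / r ^+ 2 * m = alpha * beta / 2.
    by rewrite /m; field; rewrite gt_eqF.
  by lra.
(* This is [(alpha / lambda)^mu] with [lambda = alpha / r^2]. *)
have -> : r `^ (2 * alpha * a / beta) = expR (- (mu * s)) * expR (mu * ln alpha).
  rewrite /powR gt_eqF// -expRD; congr expR; rewrite /s /mu.
  by field; rewrite gt_eqF.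
rewrite muleAC -EFinM mulrA -/c EFinM -muleA.
apply: lee_wpmul2l; first by rewrite lee_fin.
have e0 x : [set: borel M] x -> (0 <= (expR (- alpha * f x))%:E)%E.
  by rewrite lee_fin expR_ge0.
have E0 : (0 <= (expR (mu * ln alpha))%:E)%E by rewrite lee_fin expR_ge0.
rewrite -(ge0_integralZl vol measurableT mE e0 E0); apply: (le_trans Is).
apply: ge0_le_integral => //.
- by move=> x _; rewrite lee_fin.
- exact: measurable_funeM.
(* At [lambda = alpha] the integrand is the cutoff times [alpha^mu e^(-alpha f)], and the cutoff is
   at most [1]. *)
move=> x _; rewrite -EFinM lee_fin -expRD mulNr lnK//.
by rewrite ler_piMl// cutoff_le1.
Qed.

End weighted_volume.

Theorem theorem1p1 (R : realType) (n : nat) (M : smooth_manifold R n)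
    (g : riemannian_metric M) (g_complete : complete_metric g)
    (vol : {measure set (borel M) -> \bar R})
    (vol_g : is_riemannian_volume g vol)
    (P : bundle_endomorphism M) (P_sym : symmetric_endo g P)
    (f : M -> R) (f_C2 : Ck_manifold 2 f) (f_proper : proper_map f)
    (f_ge0 : forall x, 0 <= f x)
    (alpha beta a : R) (alpha_gt0 : 0 < alpha) (beta_gt0 : 0 < beta)
    (a_ge0 : 0 <= a)
    (h1 : forall i x, chart_dom i x ->
      divergence g (endo_apply P (grad g f)) i x
      - alpha * inner_field g (endo_apply P (grad g f)) (grad g f) i x
      + beta * f x <= a)
    (h2 : forall i x, chart_dom i x ->
      divergence g (endo_apply P (grad g f)) i x <= a)
    (h3 : forall i x, chart_dom i x ->
      0 <= inner_field g (endo_apply P (grad g f)) (grad g f) i x) :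
  (\int[vol]_x (expR (- alpha * f x))%:E < +oo)%E /\
  (forall r : R, 1 <= r ->
    (vol [set x | (2 * Num.sqrt (f x) <= Num.sqrt (2 * beta) * r)%R]
     <= (expR (alpha * beta / 2))%:E
        * (\int[vol]_x (expR (- alpha * f x))%:E)
        * (r `^ (2 * alpha * a / beta))%:E)%E).
Proof.
split.
  exact: (integral_expR_lty vol_g f_C2 f_proper f_ge0 alpha_gt0 beta_gt0 a_ge0 h1 h2 h3).
exact: (volume_sublevel vol_g f_C2 f_proper f_ge0 alpha_gt0 beta_gt0 a_ge0 h1 h2 h3).
Qed.
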